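(* Assume that $\sum_{k=0}^\infty\|B(k)\|<\infty$ and that the set $\Sigma$ associated with the equation $$x(n+1)=Ax(n)+\sum_{k=0}^n B(n-k)x(k),\qquad n\in\mathbb N_0, \qquad (E)$$ is countable. Then the following assertions hold: (i) If $x=(x(n))$ is a bounded solution of (E) such that for each $\xi_0\in\Sigma$ $$\lim_{\lambda\downarrow\xi_0}(\lambda-\xi_0)R(\lambda,\bar S)\bar x=0 \quad\text{in } l^\infty(\mathbb X)/c_0(\mathbb X),$$ then $x$ is asymptotically stable, i.e. $\lim_{n\to\infty}x(n)=0$. (ii) If the resolvent sequence $X=(X(n))$ of (E) is bounded and for each $\xi_0\in\Sigma$ $$\lim_{\lambda\downarrow\xi_0}(\lambda-\xi_0)R(\lambda,\bar S)\bar X=0 \quad\text{in } l^\infty(L(\mathbb X))/c_0(L(\mathbb X)),$$ then (E) is asymptotically stable, i.e. $\lim_{n\to\infty}X(n)=0$ in $L(\mathbb X)$.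
   Context: $\mathbb X$ is a complex Banach space, $L(\mathbb X)$ the Banach algebra of bounded linear operators on $\mathbb X$, $\mathbb N_0=\{0,1,2,\dots\}$, $\Gamma=\{z\in\mathbb C:|z|=1\}$; $A\in L(\mathbb X)$ and $B(n)\in L(\mathbb X)$ for $n\in\mathbb N_0$. For a Banach space $\mathbb W$ (here $\mathbb W=\mathbb X$ or $\mathbb W=L(\mathbb X)$), $l^\infty(\mathbb W)$ is the space of bounded sequences $(x(n))_{n\ge0}$ in $\mathbb W$ with the sup-norm and $c_0(\mathbb W)$ is its closed subspace of sequences converging to $0$. The translation $S$ on $l^\infty(\mathbb W)$, $(Sx)(n)=x(n+1)$, induces a surjective isometry $\bar S$ on the quotient $l^\infty(\mathbb W)/c_0(\mathbb W)$, so $\sigma(\bar S)\subset\Gamma$. The class of $x$ in the quotient is denoted $\bar x$, and $R(\lambda,\bar S)=(\lambda-\bar S)^{-1}$ for $|\lambda|\ne1$. For $\xi_0\in\Gamma$, $\lim_{\lambda\downarrow\xi_0}F(\lambda):=\lim_{s\downarrow1}F(s\xi_0)$ (radial limit from outside the unit circle). The Z-transform of $(B(n))$ is $\tilde B(z)=\sum_{j=0}^\infty B(j)z^{-j}$, $|z|>1$. A point $z_0\in\Gamma$ is called regular with respect to (E) if there is a neighborhood of $z_0$ in $\mathbb C$ (which may be taken to be an open disk centered at $z_0$) in which $(z-A-\tilde B(z))^{-1}$ exists as an element of $L(\mathbb X)$ for each $z$ and is holomorphic in $z$; here, at points with $|z|\le1$, $\tilde B(z)$ denotes the value of a holomorphic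 extension of $\tilde B$ from $\{|z|>1\}$ to that neighborhood (which is required to exist). $\Sigma$ is the set of all points of $\Gamma$ that are not regular. The resolvent sequence $(X(n))_{n\ge0}\subset L(\mathbb X)$ of (E) is the unique operator sequence with $X(0)=I$ and $X(n+1)=AX(n)+\sum_{j=0}^nB(n-j)X(j)$ for all $n\in\mathbb N_0$. *)

(* Defs.v *)
From HB Require Import structures.
From mathcomp Require Import all_boot all_order all_algebra.
From mathcomp Require Import complex.
From mathcomp Require Import all_classical all_reals all_analysis.

Set Implicit Arguments.
Unset Strict Implicit.
Unset Printing Implicit Defensive.

Import Order.TTheory GRing.Theory Num.Theory.
Import numFieldNormedType.Exports.

Local Open Scope classical_set_scope.
Local Open Scope ring_scope.
Local Open Scope complex_scope.

(* The norm of a normed module over R[i] takes its values in R[i]; rnorm is the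
   same norm seen as a real number (see rnormE). *)
Section RealNorm.
Context {R : realType} {V : normedModType R[i]}.
Implicit Types x y : V.

Definition rnorm x : R := complex.Re `|x|.

Lemma rnormE x : `|x| = (rnorm x)%:C.
Proof.
rewrite /rnorm; have := normr_ge0 x; case: `|x| => a b.
by rewrite lecE/= => /andP[/eqP ->].
Qed.

Lemma rnorm_ge0 x : 0 <= rnorm x.
Proof. by have := normr_ge0 x; rewrite rnormE lecR. Qed.

Lemma rnorm0 : rnorm 0 = 0.
Proof. by rewrite /rnorm normr0. Qed.

Lemma rnormD x y : rnorm (x + y) <= rnorm x + rnorm y.
Proof. by have := ler_normD x y; rewrite !rnormE -rmorphD lecR. Qed.

Lemma rnorm0_eq0 x : rnorm x = 0 -> x = 0.
Proof. by move=> x0; apply/eqP; rewrite -normr_eq0 rnormE x0. Qed.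

End RealNorm.

Lemma rnormZ {R : realType} {V : normedModType R[i]} (a : R[i]) (x : V) :
  rnorm (a *: x) = rnorm (a : R[i]^o) * rnorm x.
Proof.
have /(congr1 (@complex.Re R)) := normrZ a x.
by rewrite (rnormE (a : R[i]^o)) (rnormE x) -rmorphM.
Qed.

Section SupNorm.
Context {R : realType} {T : Type} {W : normedModType R[i]}.
Implicit Types (D : set T) (f g : T -> W).

(* sup of the norm of f over D (0 when D is empty) *)
Definition supnorm D f : R := sup [set rnorm (f t) | t in D].

Definition rbounded D f := exists M : R, forall t, D t -> rnorm (f t) <= M.

Lemma supnorm_ub D f t : rbounded D f -> D t -> rnorm (f t) <= supnorm D f.
Proof.
move=> [M fM] Dt; apply: ub_le_sup; last by exists t.
by exists M => _ [s Ds <-]; exact: fM.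
Qed.

Lemma supnorm_le D f M : D !=set0 -> (forall t, D t -> rnorm (f t) <= M) ->
  supnorm D f <= M.
Proof.
move=> [t Dt] fM; apply: ge_sup; first by exists (rnorm (f t)), t.
by move=> _ [s Ds <-]; exact: fM.
Qed.

Lemma supnormD D f g : D !=set0 -> rbounded D f -> rbounded D g ->
  supnorm D (f \+ g) <= supnorm D f + supnorm D g.
Proof.
move=> D0 fb gb; apply: supnorm_le => // t Dt.
by rewrite (le_trans (rnormD _ _))// lerD// supnorm_ub.
Qed.

Lemma supnormZ D f (a : R[i]) : D !=set0 -> rbounded D f ->
  supnorm D (a \*: f) = rnorm (a : R[i]^o) * supnorm D f.
Proof.
move=> D0 fb; apply/eqP; rewrite eq_le; apply/andP; split.
  apply: supnorm_le => // t Dt; rewrite rnormZ.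
  by rewrite ler_wpM2l ?rnorm_ge0 ?supnorm_ub.
have [->|a0] := eqVneq a 0.
  rewrite rnorm0 mul0r; have [t Dt] := D0.
  apply: (le_trans (rnorm_ge0 ((0 \*: f) t))); apply: supnorm_ub => //.
  by exists 0 => s _; rewrite /= scale0r rnorm0.
have na : 0 < rnorm (a : R[i]^o).
  rewrite lt_neqAle rnorm_ge0 andbT eq_sym; apply: contraNneq a0.
  by move=> /rnorm0_eq0 ->.
rewrite -ler_pdivlMl//; apply: supnorm_le => // t Dt.
rewrite ler_pdivlMl// -rnormZ; apply: (@supnorm_ub _ (a \*: f)) => //.
have [M fM] := fb; exists (rnorm (a : R[i]^o) * M) => s Ds.
by rewrite rnormZ ler_wpM2l ?rnorm_ge0 ?fM.
Qed.

Lemma supnorm0 D f t : rbounded D f -> supnorm D f = 0 -> D t -> f t = 0.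
Proof.
move=> fb f0 Dt; apply: rnorm0_eq0; apply/eqP.
by rewrite eq_le rnorm_ge0 andbT -f0 supnorm_ub.
Qed.

End SupNorm.

Section BoundedSequences.
Context {R : realType} (W : normedModType R[i]).

Definition bounded_seq : {pred (nat -> W)} := [pred x | `[< bounded_fun x >]].

Lemma bounded_seqP (x : nat -> W) : x \in bounded_seq <-> rbounded setT x.
Proof.
have FT : ProperFilter (globally [set: nat]).
  by apply: (@globally_properfilter _ _ 0%N).
rewrite inE; split=> [xb|[M xM]].
  have [M xM] := (ex_bound _).1 xb.
  exists (complex.Re M) => n _; have := xM n I.
  by rewrite /= rnormE lecE/= => /andP[].
apply: (ex_bound _).2; exists M%:C => n _ /=.
by rewrite rnormE lecR xM.
Qed.

Fact bounded_seq_submod : submod_closed bounded_seq.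
Proof.
split.
  by apply/bounded_seqP; exists 0 => n _; rewrite rnorm0.
move=> a x y /bounded_seqP [M xM] /bounded_seqP [N yN]; apply/bounded_seqP.
exists (rnorm (a : R[i]^o) * M + N) => n _.
rewrite (le_trans (rnormD _ _))// lerD ?yN// rnormZ.
by rewrite ler_wpM2l ?rnorm_ge0 ?xM.
Qed.

HB.instance Definition _ :=
  GRing.isSubmodClosed.Build R[i] (nat -> W) bounded_seq bounded_seq_submod.

Record linf := Linf { linf_val :> nat -> W ; _ : linf_val \in bounded_seq }.

HB.instance Definition _ := [isSub for linf_val].
HB.instance Definition _ := [Choice of linf by <:].
HB.instance Definition _ := [SubChoice_isSubLmodule of linf by <:].

Lemma linf_bounded (x : linf) : rbounded setT x.
Proof. exact/bounded_seqP/valP. Qed.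

Let T0 : [set: nat] !=set0. Proof. by exists 0%N. Qed.

Definition linf_norm (x : linf) : R[i] := (supnorm setT x)%:C.

Fact linf_normD x y : linf_norm (x + y) <= linf_norm x + linf_norm y.
Proof.
rewrite -rmorphD lecR; apply: supnormD => //; exact: linf_bounded.
Qed.

Fact linf_normZ (a : R[i]) x : linf_norm (a *: x) = `|a| * linf_norm x.
Proof.
rewrite (rnormE (a : R[i]^o)) -rmorphM; congr (_%:C).
by apply: supnormZ => //; exact: linf_bounded.
Qed.

Fact linf_norm0 x : linf_norm x = 0 -> x = 0.
Proof.
move=> /(congr1 (@complex.Re R))/= x0; apply/val_inj/funext => n.
by apply: (supnorm0 _ x0) => //; exact: linf_bounded.
Qed.

HB.instance Definition _ := Lmodule_isNormed.Build R[i] linf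
  linf_normD linf_normZ linf_norm0.

End BoundedSequences.

Section BoundedOperators.
Context {R : realType} (V : normedModType R[i]).

Definition bounded_linear (f : V -> V) :=
  linear f /\ exists M : R, forall x, rnorm (f x) <= M * rnorm x.

Definition bounded_op : {pred (V -> V)} := [pred f | `[< bounded_linear f >]].

Lemma bounded_opP (f : V -> V) : reflect (bounded_linear f) (f \in bounded_op).
Proof. by rewrite unfold_in; exact: asboolP. Qed.

Fact bounded_op_submod : submod_closed bounded_op.
Proof.
split.
  apply/bounded_opP; split; first by move=> a x y; rewrite scaler0 addr0.
  by exists 0 => x; rewrite mul0r rnorm0.
move=> a f g /bounded_opP [fL [M fM]] /bounded_opP [gL [N gN]].
apply/bounded_opP; split.
  move=> b x y /=; rewrite !fctE fL gL !scalerDr !scalerA (mulrC b).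
  by rewrite addrACA.
exists (rnorm (a : R[i]^o) * M + N) => x.
rewrite (le_trans (rnormD _ _))// mulrDl lerD ?gN// rnormZ -mulrA.
by rewrite ler_wpM2l ?rnorm_ge0 ?fM.
Qed.

HB.instance Definition _ :=
  GRing.isSubmodClosed.Build R[i] (V -> V) bounded_op bounded_op_submod.

Record blop := Blop { blop_val :> V -> V ; _ : blop_val \in bounded_op }.

HB.instance Definition _ := [isSub for blop_val].
HB.instance Definition _ := [Choice of blop by <:].
HB.instance Definition _ := [SubChoice_isSubLmodule of blop by <:].

Lemma blop_linear (f : blop) : linear f.
Proof. by have /bounded_opP[] := valP f. Qed.

HB.instance Definition _ (f : blop) :=
  GRing.isLinear.Build R[i] V V *:%R f (blop_linear f).

Definition unit_ball : set V := [set x | `|x| <= 1].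

Lemma blop_bounded (f : blop) : rbounded unit_ball f.
Proof.
have /bounded_opP[_ [M fM]] := valP f; exists `|M| => x.
rewrite /unit_ball/= rnormE lecR => x1; rewrite (le_trans (fM x))//.
rewrite (le_trans (ler_wpM2r (rnorm_ge0 _) (ler_norm M)))//.
by rewrite ler_piMr.
Qed.

Let B0 : unit_ball !=set0. Proof. by exists 0; rewrite /unit_ball/= normr0. Qed.

Definition blop_norm (f : blop) : R[i] := (supnorm unit_ball f)%:C.

Fact blop_normD f g : blop_norm (f + g) <= blop_norm f + blop_norm g.
Proof.
rewrite -rmorphD lecR; apply: supnormD => //; exact: blop_bounded.
Qed.

Fact blop_normZ (a : R[i]) f : blop_norm (a *: f) = `|a| * blop_norm f.
Proof.
rewrite (rnormE (a : R[i]^o)) -rmorphM; congr (_%:C).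
by apply: supnormZ => //; exact: blop_bounded.
Qed.

Fact blop_norm0 f : blop_norm f = 0 -> f = 0.
Proof.
move=> /(congr1 (@complex.Re R))/= f0; apply/val_inj/funext => x /=.
have [->|x0] := eqVneq x 0; first by rewrite linear0.
have : f (`|x|^-1 *: x) = 0.
  apply: (supnorm0 (blop_bounded f) f0).
  by rewrite /unit_ball/= normrZ normfV normr_id mulVf ?normr_eq0.
by rewrite linearZ/= => /eqP; rewrite scaler_eq0 invr_eq0 normr_eq0 (negPf x0)
  => /eqP.
Qed.

HB.instance Definition _ := Lmodule_isNormed.Build R[i] blop
  blop_normD blop_normZ blop_norm0.

Fact bounded_op1 : id \in bounded_op.
Proof.
by apply/bounded_opP; split=> [a x y //|]; exists 1 => x; rewrite mul1r.
Qed.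

Fact bounded_op_comp (f g : blop) : f \o g \in bounded_op.
Proof.
have /bounded_opP[_ [M fM]] := valP f; have /bounded_opP[_ [N gN]] := valP g.
apply/bounded_opP; split=> [a x y /=|]; first by rewrite !linearP.
exists (`|M| * N) => x /=.
rewrite (le_trans (fM _))// (le_trans (ler_wpM2r (rnorm_ge0 _) (ler_norm M)))//.
by rewrite -mulrA ler_wpM2l.
Qed.

Definition blop1 : blop := Blop bounded_op1.
Definition blop_mul (f g : blop) : blop := Blop (bounded_op_comp f g).

Fact blop_mulA : associative blop_mul.
Proof. by move=> f g h; apply/val_inj. Qed.

Fact blop_mul1l : left_id blop1 blop_mul.
Proof. by move=> f; apply/val_inj. Qed.

Fact blop_mul1r : right_id blop1 blop_mul.
Proof. by move=> f; apply/val_inj. Qed.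

Fact blop_mulDl : left_distributive blop_mul +%R.
Proof. by move=> f g h; apply/val_inj. Qed.

Fact blop_mulDr : right_distributive blop_mul +%R.
Proof. by move=> f g h; apply/val_inj/funext => x /=; rewrite !fctE linearD. Qed.

(* Only a pzRingType: 1 = 0 when V is the zero space. *)
HB.instance Definition _ := GRing.Zmodule_isPzRing.Build blop
  blop_mulA blop_mul1l blop_mul1r blop_mulDl blop_mulDr.

Definition invertible (f : blop) := exists g : blop, g * f = 1 /\ f * g = 1.

(* junk value when f is not invertible *)
Definition blop_inv (f : blop) : blop :=
  get [set g : blop | g * f = 1 /\ f * g = 1].

Lemma blop_invP (f : blop) : invertible f ->
  blop_inv f * f = 1 /\ f * blop_inv f = 1.
Proof. by move=> fi; exact: (getPex fi). Qed.

Definition resolvent (l : R[i]) (f : blop) : blop := blop_inv (l *: (1 : blop) - f).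

End BoundedOperators.

Section QuotientByNullSequences.
Context {R : realType} (W : normedModType R[i]).

Definition null_seq : {pred (linf W)} :=
  [pred x : linf W | `[< x n @[n --> \oo] --> (0 : W) >]].

Lemma null_seqP (x : linf W) :
  reflect (x n @[n --> \oo] --> (0 : W)) (x \in null_seq).
Proof. by rewrite unfold_in; exact: asboolP. Qed.

Fact null_seq_submod : submod_closed null_seq.
Proof.
split; first by apply/null_seqP; exact: cvg_cst.
move=> a x y /null_seqP x0 /null_seqP y0; apply/null_seqP.
rewrite -[0](addr0 0) -{1}(scaler0 _ a).
by apply: cvgD => //; apply: cvgZr.
Qed.

HB.instance Definition _ :=
  GRing.isSubmodClosed.Build R[i] (linf W) null_seq null_seq_submod.

Definition linf_c0 := Quotient.quot null_seq.

HB.instance Definition _ := GRing.Zmodule.on linf_c0.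

Definition qclass (x : linf W) : linf_c0 := \pi_linf_c0%qT x.

Lemma qclassK (q : linf_c0) : qclass (repr q) = q.
Proof. exact: reprK. Qed.

Lemma qclass_eqP (x y : linf W) :
  qclass x = qclass y <-> (x - y) n @[n --> \oo] --> (0 : W).
Proof.
have E : (x - y \in null_seq) = (qclass x == qclass y).
  exact: Quotient.idealrBE.
split=> [/eqP|/null_seqP]; first by rewrite -E => /null_seqP.
by rewrite E => /eqP.
Qed.

Lemma qclassD : {morph qclass : x y / x + y}.
Proof. exact: Quotient.pi_add. Qed.

Lemma qclass0 : qclass 0 = 0.
Proof. by apply: (@addrI _ (qclass 0)); rewrite -qclassD !addr0. Qed.

Definition qscale (a : R[i]) (q : linf_c0) : linf_c0 := qclass (a *: repr q).

Lemma qclassZ a x : qclass (a *: x) = qscale a (qclass x).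
Proof.
apply/qclass_eqP/null_seqP; rewrite -scalerBr.
by apply: rpredZ; apply/null_seqP/qclass_eqP; rewrite qclassK.
Qed.

Fact qscaleA a b q : qscale a (qscale b q) = qscale (a * b) q.
Proof. by rewrite -[q]qclassK -!qclassZ scalerA. Qed.

Fact qscale1 : left_id 1 qscale.
Proof. by move=> q; rewrite -[q]qclassK -!qclassZ scale1r. Qed.

Fact qscaleDr : right_distributive qscale +%R.
Proof.
move=> a p q; rewrite -[p]qclassK -[q]qclassK.
by rewrite -qclassD -!qclassZ -qclassD scalerDr.
Qed.

Fact qscaleDl q : {morph qscale^~ q : a b / a + b}.
Proof. by move=> a b; rewrite -[q]qclassK -!qclassZ -qclassD scalerDl. Qed.

HB.instance Definition _ := GRing.Zmodule_isLmodule.Build R[i] linf_c0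
  qscaleA qscale1 qscaleDr qscaleDl.

Definition qdist (q : linf_c0) : R :=
  inf [set rnorm x | x in [set x : linf W | qclass x = q]].

Definition qnorm (q : linf_c0) : R[i] := (qdist q)%:C.

Lemma qdist_le x : qdist (qclass x) <= rnorm x.
Proof.
apply: ge_inf; last by exists x.
by exists 0 => _ [y _ <-]; exact: rnorm_ge0.
Qed.

Lemma le_qdist q M : (forall x, qclass x = q -> M <= rnorm x) -> M <= qdist q.
Proof.
move=> Mq; apply: lb_le_inf.
  by exists (rnorm (repr q)), (repr q) => //=; exact: qclassK.
by move=> _ [y yq <-]; exact: Mq.
Qed.

Lemma qdist_ge0 q : 0 <= qdist q.
Proof. by apply: le_qdist => x _; exact: rnorm_ge0. Qed.

Fact qnormD p q : qnorm (p + q) <= qnorm p + qnorm q.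
Proof.
rewrite -rmorphD lecR -lerBlDr; apply: le_qdist => x xp.
rewrite lerBlDl -lerBlDr; apply: le_qdist => y yq.
rewrite lerBlDr addrC -xp -yq -qclassD.
by rewrite (le_trans (qdist_le _))// rnormD.
Qed.

Lemma qdistZ_le a q : qdist (a *: q) <= rnorm (a : R[i]^o) * qdist q.
Proof.
have [->|a0] := eqVneq a 0.
  rewrite rnorm0 mul0r scale0r -[0](qclassK).
  by rewrite qclassK -qclass0 (le_trans (qdist_le _))// rnorm0.
have na : 0 < rnorm (a : R[i]^o).
  rewrite lt_neqAle rnorm_ge0 andbT eq_sym; apply: contraNneq a0.
  by move=> /rnorm0_eq0 ->.
rewrite -ler_pdivrMl//; apply: le_qdist => x <-.
by rewrite ler_pdivrMl// -rnormZ -[a *: _]qclassZ qdist_le.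
Qed.

Fact qnormZ (a : R[i]) q : qnorm (a *: q) = `|a| * qnorm q.
Proof.
rewrite (rnormE (a : R[i]^o)) -rmorphM; congr (_%:C).
apply/eqP; rewrite eq_le qdistZ_le/=.
have [->|a0] := eqVneq a 0; first by rewrite rnorm0 mul0r qdist_ge0.
have := qdistZ_le a^-1 (a *: q); rewrite scalerA mulVf// scale1r => h.
rewrite (le_trans (ler_wpM2l (rnorm_ge0 _) h))// mulrA.
have := rnormZ a (a^-1 : R[i]^o); rewrite /GRing.scale/= mulfV// => <-.
by rewrite /rnorm normr1 mul1r.
Qed.

Fact qnorm0 q : qnorm q = 0 -> q = 0.
Proof.
move=> /(congr1 (@complex.Re R))/= q0.
have h0 : has_inf [set rnorm x | x in [set x : linf W | qclass x = q]].
  split; first by exists (rnorm (repr q)), (repr q) => //=; exact: qclassK.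
  by exists 0 => _ [y _ <-]; exact: rnorm_ge0.
rewrite -qclass0 -[q]qclassK; apply/qclass_eqP; rewrite subr0.
apply/cvgr0Pnorm_le => e e0.
have eR : e = (complex.Re e)%:C.
  by move: e0; case: e => a b; rewrite ltcE/= => /andP[/eqP ->].
have e1 : 0 < complex.Re e by move: e0; rewrite eR ltcR.
have [_ [y yq <-] ye] := inf_adherent (divr_gt0 e1 (ltr0Sn R 1)) h0.
rewrite -/(qdist q) q0 add0r in ye.
have /qclass_eqP/cvgr0Pnorm_le xy : qclass (repr q) = qclass y.
  by rewrite qclassK.
have e2 : (0 : R[i]) < (complex.Re e / 2)%:C by rewrite ltcR divr_gt0.
have := xy _ e2; apply: filterS => n /= xyn.
rewrite -[linf_val (repr q) n](subrK (linf_val y n)) eR.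
rewrite (le_trans (ler_normD _ _))// [complex.Re e]splitr rmorphD lerD//.
rewrite rnormE lecR (le_trans _ (ltW ye))//.
by apply: (supnorm_ub (linf_bounded y)).
Qed.

HB.instance Definition _ := Lmodule_isNormed.Build R[i] linf_c0
  qnormD qnormZ qnorm0.

End QuotientByNullSequences.

Section Translation.
Context {R : realType} (W : normedModType R[i]).

Fact shift_bounded (x : linf W) : (fun n => x n.+1) \in @bounded_seq R W.
Proof.
by apply/bounded_seqP; have [M xM] := linf_bounded x; exists M => n _; exact: xM.
Qed.

Definition shiftS (x : linf W) : linf W := Linf (shift_bounded x).

Lemma shiftS_linear : linear shiftS.
Proof. by move=> a x y; apply/val_inj. Qed.

Definition shiftSbar_fun (q : linf_c0 W) : linf_c0 W := qclass (shiftS (repr q)).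

Lemma shiftSbar_qclass x : shiftSbar_fun (qclass x) = qclass (shiftS x).
Proof.
apply/qclass_eqP.
have /qclass_eqP : qclass (repr (qclass x)) = qclass x by rewrite qclassK.
by rewrite -(cvg_shiftS (fun n => linf_val (repr (qclass x) - x) n)).
Qed.

Fact shiftSbar_bounded : shiftSbar_fun \in @bounded_op R (linf_c0 W).
Proof.
apply/bounded_opP; split.
  move=> a p q; rewrite -[p]qclassK -[q]qclassK -[a *: _]qclassZ -qclassD.
  by rewrite !shiftSbar_qclass shiftS_linear qclassD qclassZ.
exists 1 => q; rewrite mul1r; apply: le_qdist => x <-.
rewrite shiftSbar_qclass (le_trans (qdist_le _))//.
apply: supnorm_le => [|n _]; first by exists 0%N.
by apply: (supnorm_ub (linf_bounded x)).
Qed.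

Definition shiftSbar : blop (linf_c0 W) := Blop shiftSbar_bounded.

End Translation.

Section VolterraEquation.
Context {R : realType} {X : completeNormedModType R[i]}.
Variables (A : blop X) (B : nat -> blop X).

Definition solution (x : nat -> X) :=
  forall n, x n.+1 = A (x n) + \sum_(k < n.+1) B (n - k)%N (x k).

Definition resolvent_sequence (U : nat -> blop X) :=
  U 0%N = 1 /\
  forall n, U n.+1 = A * U n + \sum_(j < n.+1) B (n - j)%N * U j.

(* junk value when the series diverges; it converges for |z| > 1 when B is bounded *)
Definition Ztransform (z : R[i]) : blop X :=
  limn (series (fun j => z ^- j *: B j)).

Definition open_disk (c : R[i]) (r : R) : set R[i] :=
  [set z | `|z - c| < r%:C].

Definition holomorphic (V : normedModType R[i]) (D : set R[i])
    (F : R[i] -> V) :=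
  forall z, D z -> derivable (F : R[i]^o -> V) z 1.

(* G is the holomorphic extension of the Z-transform to the disk *)
Definition regular (z0 : R[i]) :=
  exists2 r : R, 0 < r & exists G : R[i] -> blop X,
    let D := open_disk z0 r in
    let P z := z *: (1 : blop X) - A - G z in
    [/\ holomorphic D G,
        forall z, D z -> 1 < `|z| -> G z = Ztransform z,
        forall z, D z -> invertible (P z) &
        holomorphic D (fun z => blop_inv (P z))].

Definition Sigma : set R[i] := [set z | `|z| = 1 /\ ~ regular z].

End VolterraEquation.

Definition radial_lim {R : realType} {V : normedModType R[i]}
    (F : R[i] -> V) (xi : R[i]) (v : V) :=
  F (s%:C * xi) @[s --> (1 : R)^'+] --> v.

(* Main.v *)
Require Import Defs.
From HB Require Import structures.
From mathcomp Require Import all_boot all_order all_algebra.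
From mathcomp Require Import complex.
From mathcomp Require Import all_classical all_reals all_analysis.
From mathcomp Require Import ring lra.

Set Implicit Arguments.
Unset Strict Implicit.
Unset Printing Implicit Defensive.

Import Order.TTheory GRing.Theory Num.Theory.
Import numFieldNormedType.Exports.

Local Open Scope classical_set_scope.
Local Open Scope ring_scope.
Local Open Scope complex_scope.

(** Let [W] be [X] for assertion (i) and the algebra of bounded operators for
    assertion (ii), let [q] be the class of the bounded sequence [x] in
    [linf_c0 W], and let [T] be the translation on classes, a surjective
    isometry. The point is to show that [q = 0].

    Taking Z-transforms in the equation gives [P z (x~ z) = z *: x 0], where
    [x~] is the transform of [x] and [P z = z - A - B~ z]. Hence [x~] extends
    continuously across every regular point of the unit circle
    ([regular_zpartial]); nothing more is used of holomorphy. At a point [xi] of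
    [Sigma], the identity [q - (l - xi) R q = (xi - T) R q], with [R] the
    resolvent of [T] at [l], and the radial condition show that [q] is in the
    closed range of [xi - T] ([radial_lim_closed_range]).

    From there the proof follows the theory of uniqueness of trigonometric
    series. The Riemann function
    [Phi t = t ^ 2 / 2 q - \sum_(n >= 1) (e ^ (- i n t) T ^ n q +
    e ^ (i n t) T ^ (- n) q) / n ^ 2] is continuous with values in [linf_c0 W],
    and its second differences of step [h] are bilateral sums of the orbit of
    [q] weighted by the Fourier coefficients of a tent function of width [h]. At
    regular angles these sums are [o(h ^ 2)], because the tent localizes the
    transform near the angle ([local_estimate]); at angles of [Sigma] they are
    [o(h)], by summation by parts ([second_diff_little_o]). The real function
    [g t = |Phi t - Phi (2 pi)|] is then continuous with second differences at
    least [- o(h ^ 2)] off a countable set, and at least [- o(h)] on it. A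
    maximum principle ([schwarz_nonpos]) shows that it is nonpositive between its zeros
    [- 2 pi] and [2 pi]. Since all terms but the quadratic one are
    [2 pi]-periodic, [g 0 = 2 pi ^ 2 |q|], so that [q = 0]
    ([countable_spectrum]). *)

(** * A maximum principle with countable exceptions *)

Lemma countable_inj_into (T U : Type) (A : set T) (B : set U) (f : T -> U) :
  {in A &, injective f} -> (forall x, A x -> B (f x)) ->
  countable B -> countable A.
Proof.
move=> fI fAB /countable_injP [k kI]; apply/countable_injP.
exists (k \o f) => x y xA yA /= kxy; apply: fI => //.
by apply: kI => //; apply/mem_set/fAB/set_mem.
Qed.

(** A maximum principle of Schwarz type with a countable exceptional set [C]:
    the second symmetric differences are bounded below by [- o(h ^ 2)] off [C], but
    only by [- o(h)] on [C]. If [g c] were positive, then for small [e] and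
    every small slope [s] the function [g t + e * (t - c) ^ 2 - s * (t - c)]
    would have an interior maximum; the term in [e] forces it into [C], and a
    point of [C] can serve only one slope, so [C] would be uncountable. *)
Lemma schwarz_nonpos (R : realType) (g : R -> R) (a b : R) (C : set R) :
  a < b -> continuous g -> g a <= 0 -> g b <= 0 -> countable C ->
  (forall t, a < t < b -> ~ C t -> forall e, 0 < e ->
     exists2 d, 0 < d & forall h, 0 < h < d ->
       - (e * h ^+ 2) <= g (t + h) + g (t - h) - 2 * g t) ->
  (forall t, a < t < b -> C t -> forall e, 0 < e ->
     exists2 d, 0 < d & forall h, 0 < h < d ->
       - (e * h) <= g (t + h) + g (t - h) - 2 * g t) ->
  forall c, a < c < b -> g c <= 0.
Proof.
move=> ab gc ga gb Cc gR gS c /andP[ac cb]; rewrite leNgt; apply/negP => gc0.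
set l := b - a; have l0 : 0 < l by rewrite subr_gt0.
(* e and s0 are small enough for the perturbed functions G s to stay below
   g c = G s c at both ends of the interval *)
pose e := g c / (3 * l ^+ 2).
pose s0 := g c / (3 * l).
have e0 : 0 < e by rewrite divr_gt0// mulr_gt0// exprn_gt0.
have s00 : 0 < s0 by rewrite divr_gt0// mulr_gt0.
have eE : e * l ^+ 2 = g c / 3.
  by rewrite /e; field; rewrite gt_eqF.
have sE : s0 * l = g c / 3 by rewrite /s0; field; rewrite gt_eqF.
pose G s t := g t + e * (t - c) ^+ 2 - s * (t - c).
have Gc s : {within `[a, b], continuous (G s)}.
  apply: continuous_subspaceT => t; rewrite /G.
  apply: cvgB; [apply: cvgD; [exact: gc|]|].
    apply: cvgMr; rewrite expr2.
    by apply: cvgM; apply: cvgB => //; exact: cvg_cst.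
  by apply: cvgMr; apply: cvgB => //; exact: cvg_cst.
have Gbd s t : 0 <= s <= s0 -> a <= t <= b -> g t <= 0 -> G s t < g c.
  move=> /andP[s1 s2] /andP[ta tb] gt0.
  have h1 : e * (t - c) ^+ 2 <= g c / 3.
    rewrite -eE ler_pM2l// -subr_ge0 subr_sqr /l.
    by rewrite mulr_ge0//; lra.
  have h2 : - (s * (t - c)) <= g c / 3.
    rewrite -sE -mulrN (le_trans (y := s * l))//.
      rewrite ler_wpM2l//; rewrite /l; lra.
    by rewrite ler_wpM2r// ltW.
  by rewrite /G; lra.
have ex s : exists t, 0 <= s <= s0 ->
    a < t < b /\ forall u, a <= u <= b -> G s u <= G s t.
  have [hs|hs] := pselect (0 <= s <= s0); last by exists 0.
  have [t tab tmax] := EVT_max (ltW ab) (Gc s); exists t => _.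
  have Gcc : g c <= G s t.
    have : G s c <= G s t by apply: tmax; rewrite in_itv/= !ltW.
    by rewrite {1}/G subrr expr0n/= !mulr0 addr0 subr0.
  move: tab; rewrite in_itv/= => /andP[ta tb]; split; last first.
    by move=> u uab; apply: tmax; rewrite in_itv.
  have Gt : ~ g t <= 0.
    move=> gt0; have : G s t < g c by apply: Gbd => //; rewrite ta.
    by rewrite ltNge Gcc.
  rewrite !lt_neqAle ta tb !andbT; apply/andP.
  by split; apply/eqP => tE; apply: Gt; rewrite -?tE// tE.
have [th thP] := choice ex.
have stepP t : a < t < b -> exists2 d, 0 < d & forall h, 0 < h < d ->
    a <= t + h <= b /\ a <= t - h <= b.
  move=> /andP[ta tb]; exists (Num.min (t - a) (b - t)).
    by rewrite lt_min !subr_gt0 ta.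
  by move=> h /andP[h0]; rewrite lt_min => /andP[h1 h2]; split; lra.
have D2 s t h : G s (t + h) + G s (t - h) - 2 * G s t =
    g (t + h) + g (t - h) - 2 * g t + 2 * e * h ^+ 2.
  by rewrite /G; ring.
have thC s : 0 <= s <= s0 -> C (th s).
  move=> hs; apply: contrapT => nC; have [tab tmax] := thP s hs.
  have [d d0 dP] := gR _ tab nC e e0.
  have [d' d'0 d'P] := stepP _ tab.
  pose h := Num.min d d' / 2.
  have m0 : 0 < Num.min d d' by rewrite lt_min d0.
  have h0 : 0 < h by rewrite divr_gt0.
  have hm : h < Num.min d d' by rewrite /h; lra.
  move: hm; rewrite lt_min => /andP[hd hd'].
  have := dP h; rewrite h0 hd => /(_ isT) D.
  have := d'P h; rewrite h0 hd' => /(_ isT) [/tmax G1 /tmax G2].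
  have := D2 s (th s) h; have : 0 < e * h ^+ 2 by rewrite mulr_gt0// exprn_gt0.
  by lra.
(* two slopes cannot share a maximum point t: both forward increments of
   G s at t are o(h), whereas they differ by (s - s') * h *)
have thI s s' : 0 <= s <= s0 -> 0 <= s' <= s0 -> th s = th s' -> s <= s'.
  move=> hs hs' tE; rewrite leNgt; apply/negP => ss'.
  have [tab tmax] := thP s hs; have [_ tmax'] := thP s' hs'.
  rewrite -tE in tmax'; set t := th s in tab tmax tmax'.
  have ep : 0 < (s - s') / 2 by rewrite divr_gt0// subr_gt0.
  have [d d0 dP] := gS _ tab (thC s hs) _ ep.
  have [d' d'0 d'P] := stepP _ tab.
  pose h := Num.min d d' / 2.
  have m0 : 0 < Num.min d d' by rewrite lt_min d0.
  have h0 : 0 < h by rewrite divr_gt0.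
  have hm : h < Num.min d d' by rewrite /h; lra.
  move: hm; rewrite lt_min => /andP[hd hd'].
  have := dP h; rewrite h0 hd => /(_ isT) D.
  have := d'P h; rewrite h0 hd' => /(_ isT) [hp hn].
  have G2 := tmax _ hn; have G1' := tmax' _ hp.
  have := D2 s t h.
  have : 0 < e * h ^+ 2 by rewrite mulr_gt0// exprn_gt0.
  have : G s (t + h) - G s t = G s' (t + h) - G s' t - (s - s') * h.
    by rewrite /G; ring.
  have : 0 < (s - s') * h by rewrite mulr_gt0// subr_gt0.
  by move: D G2 G1'; rewrite -/t; lra.
have : countable [set s : R | 0 <= s <= s0].
  apply: (@countable_inj_into _ _ _ _ th _ thC Cc).
  move=> s s' /set_mem hs /set_mem hs' tE.
  by apply/eqP; rewrite eq_le; apply/andP; split; apply: thI.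
have -> : [set s : R | 0 <= s <= s0] = `[0, s0]%classic.
  by rewrite set_itvE.
move=> /countable_lebesgue_measure0; rewrite lebesgue_measure_itv/= lte_fin s00.
by rewrite sube0 => -[]; apply/eqP; rewrite gt_eqF.
Qed.

(** * Real norms and points of the unit circle *)

Section RealNormTheory.
Context {R : realType} {V : normedModType R[i]}.
Implicit Types x y : V.

Lemma rnormN x : rnorm (- x) = rnorm x.
Proof. by rewrite /rnorm normrN. Qed.

Lemma rnormB x y : rnorm (x - y) <= rnorm x + rnorm y.
Proof. by rewrite -(rnormN y) rnormD. Qed.

Lemma rnorm_distC x y : rnorm (x - y) = rnorm (y - x).
Proof. by rewrite -rnormN opprB. Qed.

Lemma rnorm_le_add x y : rnorm x <= rnorm y + rnorm (x - y).
Proof. by rewrite -{1}(subrK y x) addrC rnormD. Qed.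

Lemma rnorm_dist x y : `|rnorm x - rnorm y| <= rnorm (x - y).
Proof.
rewrite ler_norml; have := rnorm_le_add x y; have := rnorm_le_add y x.
by rewrite (rnorm_distC y x); lra.
Qed.

Lemma rnorm_sum (I : Type) (r : seq I) (P : pred I) (F : I -> V) :
  rnorm (\sum_(i <- r | P i) F i) <= \sum_(i <- r | P i) rnorm (F i).
Proof.
apply: (big_ind2 (fun a b => rnorm a <= b)); first by rewrite rnorm0.
  by move=> a b c d ab cd; rewrite (le_trans (rnormD _ _))// lerD.
by [].
Qed.

End RealNormTheory.

(** The modulus of a complex number, as a real number. *)
Notation cabs a := (rnorm (a : _^o)).

Section Cis.
Context {R : realType}.
Implicit Types (a b t u h d : R).

Lemma cabsM (a b : R[i]) : cabs (a * b) = cabs a * cabs b.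
Proof. exact: (rnormZ a (b : R[i]^o)). Qed.

Lemma cabsE (a : R[i]) :
  cabs a = Num.sqrt (complex.Re a ^+ 2 + complex.Im a ^+ 2).
Proof. by rewrite /rnorm normc_def. Qed.

Lemma cabs_real t : cabs t%:C = `|t|.
Proof. by rewrite cabsE /= expr0n addr0 sqrtr_sqr. Qed.

Lemma realCM t u : (t * u)%:C = t%:C * u%:C :> R[i].
Proof. exact: (rmorphM (real_complex R)). Qed.

Lemma realCB t u : (t - u)%:C = t%:C - u%:C :> R[i].
Proof. exact: (rmorphB (real_complex R)). Qed.

Lemma realCD t u : (t + u)%:C = t%:C + u%:C :> R[i].
Proof. exact: (rmorphD (real_complex R)). Qed.

Lemma realC_nat (n : nat) : (n%:R)%:C = n%:R :> R[i].
Proof. exact: (rmorph_nat (real_complex R)). Qed.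

(** The point of angle t on the unit circle. *)
Definition cis t : R[i] := cos t +i* sin t.

Lemma cis0 : cis 0 = 1.
Proof. by rewrite /cis cos0 sin0. Qed.

Lemma cisD t u : cis (t + u) = cis t * cis u.
Proof.
rewrite /cis cosD sinD; apply/eqP; rewrite eq_complex /=.
by apply/andP; split; apply/eqP; ring.
Qed.

Lemma cisNK t : cis (- t) * cis t = 1.
Proof. by rewrite -cisD addNr cis0. Qed.

Lemma cabs_cis t : cabs (cis t) = 1.
Proof. by rewrite cabsE /= cos2Dsin2 sqrtr1. Qed.

Lemma cisMn t n : cis (t *+ n) = cis t ^+ n.
Proof. by elim: n => [|n IH]; rewrite ?mulr0n ?cis0// mulrS cisD IH exprS. Qed.

Lemma one_sub_cis t : (1 - cis t) * (1 - cis (- t)) = (2 - 2 * cos t)%:C.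
Proof.
rewrite mulrBl mul1r mulrBr mulr1 [cis t * _]mulrC cisNK.
rewrite /cis cosN sinN; apply/eqP; rewrite eq_complex /=; apply/andP.
by split; apply/eqP; ring.
Qed.

Lemma sin_mvt u : 0 < u -> exists2 x, 0 < x < u & sin u = cos x * u.
Proof.
move=> u0.
have sc : {within `[0, u], continuous (@sin R)}.
  exact/continuous_subspaceT/continuous_sin.
have [x] := MVT u0 (fun x _ => is_derive_sin x) sc.
by rewrite in_itv/= sin0 !subr0 => xu ->; exists x.
Qed.

Lemma norm_sin_le u : 0 < u -> `|sin u| <= u.
Proof.
move=> u0; have [x _ ->] := sin_mvt u0.
by rewrite normrM (gtr0_norm u0) ler_piMl ?cos_max// ltW.
Qed.

Lemma two_sub_cos u : 2 - 2 * cos u = 4 * sin (u / 2) ^+ 2.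
Proof.
have {1}-> : u = (u / 2) *+ 2 by rewrite -mulr_natr divfK.
by rewrite cos_mulr2n cos2sin2 !mulr2n; ring.
Qed.

Lemma two_sub_cos_bounds u :
  u ^+ 2 - u ^+ 4 / 4 <= 2 - 2 * cos u <= u ^+ 2.
Proof.
wlog u0 : u / 0 < u => [hw|].
  have [u0|u0|->] := ltgtP u 0; last by rewrite cos0 !expr0n/=; lra.
    have := hw (- u); rewrite oppr_gt0 cosN => /(_ u0).
    by rewrite (_ : (- u) ^+ 4 = u ^+ 4) ?sqrrN//; ring.
  exact: hw.
have v0 : 0 < u / 2 by rewrite divr_gt0.
apply/andP; split; last first.
  rewrite two_sub_cos -real_normK ?num_real//.
  set s := `|_|; have s0 : 0 <= s by exact: normr_ge0.
  have : s ^+ 2 <= (u / 2) ^+ 2.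
    by rewrite ler_pXn2r// ?nnegrE ?(ltW v0)// norm_sin_le.
  by rewrite expr_div_n; set y := s ^+ 2; lra.
have [u2|u2] := leP (u ^+ 2) 4; last first.
  have : 0 <= 2 - 2 * cos u by rewrite subr_ge0 ger_pMr// cos_le1.
  have -> : u ^+ 4 = u ^+ 2 * u ^+ 2 by ring.
  have : 0 < u ^+ 2 * (u ^+ 2 - 4) by rewrite mulr_gt0 ?subr_gt0// exprn_gt0.
  by set w := u ^+ 2; lra.
have [x /andP[x0 xv] sE] := sin_mvt v0.
have cx : 1 - (u / 2) ^+ 2 / 2 <= cos x.
  have x20 : 0 < x / 2 by rewrite divr_gt0.
  have := two_sub_cos x; rewrite -(real_normK (num_real (sin (x / 2)))).
  have := norm_sin_le x20; have := normr_ge0 (sin (x / 2)).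
  set s := `|_| => s0 sx.
  have : s ^+ 2 <= (x / 2) ^+ 2 by rewrite ler_pXn2r// nnegrE ltW.
  have : x ^+ 2 <= (u / 2) ^+ 2 by rewrite ler_pXn2r// ?nnegrE ltW.
  by rewrite !expr_div_n; set y := x ^+ 2; set z := s ^+ 2; lra.
rewrite two_sub_cos sE exprMn.
have : (1 - (u / 2) ^+ 2 / 2) ^+ 2 <= cos x ^+ 2.
  by rewrite ler_pXn2r// ?nnegrE; lra.
have -> : u ^+ 4 = u ^+ 2 * u ^+ 2 by ring.
rewrite !expr_div_n; set w := u ^+ 2; set y := cos x ^+ 2 => yw.
have w0 : 0 <= w by rewrite sqr_ge0.
have := ler_wpM2l w0 yw; have : 0 <= w * w ^+ 2 by rewrite mulr_ge0 ?sqr_ge0.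
by lra.
Qed.

Lemma cabs_one_sub_cis u : cabs (1 - cis u) <= `|u|.
Proof.
rewrite cabsE /= -sqrtr_sqr ler_sqrt ?sqr_ge0//.
have := two_sub_cos_bounds u; have := cos2Dsin2 u.
rewrite sub0r sqrrN; set c := cos u; set s := sin u => cs /andP[_ h].
have sE : s ^+ 2 = 1 - c ^+ 2 by lra.
by have -> : (1 - c) ^+ 2 + s ^+ 2 = 2 - 2 * c by rewrite sE; ring.
Qed.

End Cis.

(** * Fourier coefficients of tent functions *)

Section Kernel.
Context {R : realType}.
Implicit Types (a t u h d : R).

(** The Fourier coefficients of the tent function [t |-> max(0, h - |t|)], at a
    real frequency [u]; up to sign, what a second difference of step [h] makes of
    a coefficient [u ^- 2]. *)
Definition tent h u : R :=
  if u == 0 then h ^+ 2 else (2 - 2 * cos (u * h)) / u ^+ 2.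

Lemma tentN h u : tent h (- u) = tent h u.
Proof. by rewrite /tent oppr_eq0 mulNr cosN sqrrN. Qed.

Lemma tent_ge0 h u : 0 <= tent h u.
Proof.
rewrite /tent; case: ifP => _; first exact: sqr_ge0.
by rewrite divr_ge0 ?sqr_ge0// subr_ge0 ger_pMr// cos_le1.
Qed.

Lemma tent_le_sqr h u : tent h u <= h ^+ 2.
Proof.
rewrite /tent; case: eqVneq => // u0.
rewrite ler_pdivrMr ?exprn_even_gt0//= -exprMn (mulrC h).
by have /andP[] := two_sub_cos_bounds (u * h).
Qed.

Lemma tent_decay h u : u != 0 -> tent h u <= 4 / u ^+ 2.
Proof.
move=> u0; rewrite /tent (negPf u0) ler_pM2r ?invr_gt0 ?exprn_even_gt0//=.
set c := cos (u * h); have h1 : -1 <= c by exact: cos_geN1.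
by lra.
Qed.

(** Riemann sum for the integral that defines [tent (M * d) u]. *)
Definition tent_sum d M u : R[i] :=
  (d ^+ 2)%:C * \sum_(k < M) \sum_(l < M) cis (u * ((k%:R - l%:R) * d)).

Lemma geometric_cis a M :
  (1 - cis a) * (\sum_(k < M) cis (a * k%:R)) = 1 - cis (a * M%:R).
Proof.
elim: M => [|M IH]; first by rewrite big_ord0 !mulr0 cis0 subrr.
rewrite big_ord_recr/= mulrDr IH -[in RHS]natr1 mulrDr mulr1 cisD; ring.
Qed.

Lemma tent_sumM d M u :
  tent_sum d M u * (2 - 2 * cos (u * d))%:C =
  (d ^+ 2 * (2 - 2 * cos (u * (M%:R * d))))%:C.
Proof.
rewrite /tent_sum -mulrA realCM; congr (_ * _).
have -> : \sum_(k < M) \sum_(l < M) cis (u * ((k%:R - l%:R) * d)) =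
    (\sum_(k < M) cis (u * d * k%:R)) * (\sum_(l < M) cis (- (u * d) * l%:R)).
  rewrite big_distrl/=; apply: eq_bigr => k _; rewrite big_distrr/=.
  by apply: eq_bigr => l _; rewrite -cisD; congr cis; ring.
rewrite -!one_sub_cis [LHS]mulrC mulrACA !geometric_cis.
by congr ((1 - cis _) * (1 - cis _)); ring.
Qed.

Lemma cabs_tent_sum d M u : cabs (tent_sum d M u) <= (M%:R * d) ^+ 2.
Proof.
rewrite cabsM cabs_real ger0_norm ?sqr_ge0//.
rewrite (le_trans (ler_wpM2l (sqr_ge0 _) (rnorm_sum _ _ _)))//.
rewrite exprMn mulrC ler_wpM2r ?sqr_ge0// expr2 -natrM.
rewrite (le_trans (y := \sum_(k < M) M%:R))//; last first.
  by rewrite sumr_const card_ord natrM mulr_natr.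
apply: ler_sum => k _; rewrite (le_trans (rnorm_sum _ _ _))//.
rewrite (eq_bigr (fun=> 1)) ?sumr_const ?card_ord// => l _.
exact: cabs_cis.
Qed.

Lemma tent_sum_approx d M u :
  cabs (tent_sum d M u - (tent (M%:R * d) u)%:C) <=
  (M%:R * d) ^+ 2 * (u * d) ^+ 2 / 4.
Proof.
have [->|u0] := eqVneq u 0.
  have -> : tent_sum d M 0 = (tent (M%:R * d) 0)%:C.
    rewrite /tent eqxx /tent_sum.
    rewrite (eq_bigr (fun=> M%:R)) => [|k _]; last first.
      rewrite (eq_bigr (fun=> 1)) ?sumr_const ?card_ord// => l _.
      by rewrite mul0r cis0.
    rewrite sumr_const card_ord -[_ *+ M]mulr_natr -!realC_nat.
    by rewrite -!realCM; congr (_%:C); ring.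
  by rewrite subrr rnorm0 mul0r expr0n/= mulr0 mul0r.
have [->|d0] := eqVneq d 0.
  by rewrite /tent_sum !mulr0 expr0n/= mul0r /tent (negPf u0) mulr0 cos0 mulr1
    subrr mul0r subrr rnorm0 mul0r.
set c := (2 - 2 * cos (u * d)) / (u * d) ^+ 2.
have ud0 : u * d != 0 by rewrite mulf_neq0.
have ud20 : 0 < (u * d) ^+ 2 by rewrite exprn_even_gt0.
have cE : tent_sum d M u * c%:C = (tent (M%:R * d) u)%:C.
  rewrite /c realCM mulrA tent_sumM -realCM; congr (_%:C).
  rewrite /tent (negPf u0); field.
  by rewrite u0.
have -> : tent_sum d M u - (tent (M%:R * d) u)%:C = tent_sum d M u * (1 - c)%:C.
  by rewrite realCB mulrBr cE mulr1.
rewrite cabsM cabs_real -mulrA ler_pM ?rnorm_ge0 ?cabs_tent_sum//.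
have /andP[c1 c2] := two_sub_cos_bounds (u * d).
have : c <= 1 by rewrite ler_pdivrMr// mul1r.
have : 1 - (u * d) ^+ 2 / 4 <= c.
  rewrite ler_pdivlMr// (le_trans _ c1)// le_eqVlt; apply/orP; left; apply/eqP.
  by ring.
by move=> ? ?; rewrite ger0_norm; lra.
Qed.

(** Passing to the limit in the Riemann sums, where the difference of two
    consecutive frequencies is visibly of order [h ^+ 3]. *)
Lemma tent_lip h u : 0 <= h -> `|tent h (u + 1) - tent h u| <= h ^+ 3.
Proof.
move=> h0; apply/ler_addgt0Pr => e e0.
pose D v := h ^+ 2 * (v * h) ^+ 2 / 4.
have D0 v : 0 <= D v by rewrite /D divr_ge0// mulr_ge0// sqr_ge0.
have [M Me] : exists M : nat, (D (u + 1) + D u) / M.+1%:R <= e.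
  have := archi_boundP (divr_ge0 (addr_ge0 (D0 (u + 1)) (D0 u)) (ltW e0)).
  set M := Num.bound _ => hM; exists M.
  rewrite ler_pdivrMr// mulrC -ler_pdivrMr// (le_trans (ltW hM))//.
  by rewrite ler_nat.
pose d := h / M.+1%:R.
have d0 : 0 <= d by rewrite divr_ge0.
have hE : h = M.+1%:R * d by rewrite /d mulrC divfK.
have ap v : cabs (tent_sum d M.+1 v - (tent h v)%:C) <= D v / M.+1%:R.
  have := tent_sum_approx d M.+1 v; rewrite -hE => /le_trans; apply.
  have -> : h ^+ 2 * (v * d) ^+ 2 / 4 = D v / M.+1%:R / M.+1%:R.
    by rewrite /D /d; field.
  rewrite ler_piMr//; first exact: divr_ge0 (D0 v) (ler0n _ _).
  by rewrite invf_le1 ?ler1n.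
rewrite -cabs_real realCB.
have -> : (tent h (u + 1))%:C - (tent h u)%:C =
  (tent_sum d M.+1 (u + 1) - tent_sum d M.+1 u) +
  ((tent_sum d M.+1 u - (tent h u)%:C) -
   (tent_sum d M.+1 (u + 1) - (tent h (u + 1))%:C)) by ring.
rewrite (le_trans (rnormD (_ : R[i]^o) _))// lerD//; last first.
  rewrite (le_trans (rnormB (_ : R[i]^o) _))// (le_trans _ Me)// mulrDl addrC.
  by rewrite lerD.
have -> : tent_sum d M.+1 (u + 1) - tent_sum d M.+1 u =
    (d ^+ 2)%:C * \sum_(k < M.+1) \sum_(l < M.+1)
    (cis (u * ((k%:R - l%:R) * d)) * (cis ((k%:R - l%:R) * d) - 1)).
  rewrite /tent_sum -mulrBr -sumrB; congr (_ * _); apply: eq_bigr => k _.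
  rewrite -sumrB; apply: eq_bigr => l _.
  by rewrite mulrBr mulr1 -cisD; congr (cis _ - _); ring.
rewrite cabsM cabs_real ger0_norm ?sqr_ge0//.
have -> : h ^+ 3 = d ^+ 2 * \sum_(k < M.+1) \sum_(l < M.+1) h.
  by rewrite !sumr_const !card_ord -mulrnA -mulr_natr natrM [in LHS]hE
    [in RHS]hE; ring.
rewrite ler_wpM2l ?sqr_ge0// (le_trans (rnorm_sum _ _ _))// ler_sum// => k _.
rewrite (le_trans (rnorm_sum _ _ _))// ler_sum// => l _.
rewrite cabsM cabs_cis mul1r rnorm_distC (le_trans (cabs_one_sub_cis _))//.
rewrite normrM (ger0_norm d0) [X in _ <= X]hE ler_wpM2r//.
have /andP[k0 kM] : 0 <= (k%:R : R) <= M.+1%:R by rewrite ler0n ler_nat ltnW.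
have /andP[l0 lM] : 0 <= (l%:R : R) <= M.+1%:R by rewrite ler0n ler_nat ltnW.
by rewrite ler_norml; lra.
Qed.

(** A family bounded by [a ^+ 2] and decaying like [4 / n ^+ 2] has a sum of
    order [a]: compare with the increments of [n |-> 9 * a / (1 + n * a)]. *)
Lemma sum_tent_like (f : nat -> R) a N : 0 < a ->
  (forall n, (n < N)%N -> f n <= a ^+ 2 /\ f n <= 4 / n.+1%:R ^+ 2) ->
  \sum_(n < N) f n <= 9 * a.
Proof.
move=> a0 fle.
pose F (n : nat) := 9 * a / (1 + n%:R * a).
have D0 (n : nat) : 0 < 1 + n%:R * a by rewrite ltr_pwDl// mulr_ge0// ltW.
have step n : (n < N)%N -> f n <= F n - F n.+1.
  move=> nN; have [f1 f2] := fle n nN.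
  have -> : F n - F n.+1 = 9 * a ^+ 2 / ((1 + n%:R * a) * (1 + n.+1%:R * a)).
    rewrite /F -natr1; field.
    by rewrite nat1r !gt_eqF ?D0.
  rewrite ler_pdivlMr ?mulr_gt0//.
  rewrite -natr1 (mulrDl n%:R) mul1r; set v := n%:R * a.
  have v0 : 0 <= v by rewrite mulr_ge0// ltW.
  have p0 : 0 <= (1 + v) * (1 + (v + a)) by rewrite mulr_ge0//; lra.
  have [u2|u2] := leP (v + a) 2.
    rewrite (le_trans (ler_wpM2r p0 f1))// (mulrC 9) ler_wpM2l ?sqr_ge0//.
    have -> : (9 : R) = 3 * 3 by ring.
    by rewrite ler_pM//; lra.
  have nE : a = (v + a) / n.+1%:R.
    by rewrite /v -natr1; field; rewrite natr1.
  rewrite (le_trans (ler_wpM2r p0 f2))//.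
  have -> : 9 * a ^+ 2 = 9 * (v + a) ^+ 2 / n.+1%:R ^+ 2.
    by rewrite {1}nE expr_div_n mulrA.
  rewrite mulrAC ler_wpM2r ?invr_ge0 ?sqr_ge0//.
  have -> : 9 * (v + a) ^+ 2 = 4 * ((3 / 2 * (v + a)) * (3 / 2 * (v + a))).
    by field.
  by rewrite ler_wpM2l// ler_pM//; lra.
have F0 n : 0 <= F n by rewrite divr_ge0 ?ltW// mulr_gt0.
suff : \sum_(n < N) f n <= F 0%N - F N.
  by move=> /le_trans; apply; rewrite lerBlDr {1}/F mul0r addr0 divr1 lerDl.
elim: N fle step => [|N IH] fle step; first by rewrite big_ord0 subrr.
rewrite big_ord_recr/= -[leRHS](subrKA (F N)); apply: lerD; last exact: step.
by apply: IH => n nN; [apply: fle|apply: step]; exact: ltnW.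
Qed.

Lemma sum_inv_sqr N M : (0 < N)%N ->
  \sum_(N <= n < M) (n.+1%:R ^- 2 : R) <= N%:R^-1.
Proof.
move=> N0; have [MN|NM] := leqP M N.
  by rewrite big_geq// invr_ge0.
suff : \sum_(N <= n < M) (n.+1%:R ^- 2 : R) <= N%:R^-1 - M%:R^-1.
  by move=> /le_trans; apply; rewrite lerBlDr lerDl invr_ge0.
have -> : N%:R^-1 - M%:R^-1 = \sum_(N <= n < M) (n%:R^-1 - n.+1%:R^-1) :> R.
  rewrite (@GRing.telescope_sumr_eq _ _ _ (fun n => - n%:R^-1)) ?(ltnW NM)//.
    by rewrite opprK addrC.
  by move=> n _; rewrite opprK addrC.
rewrite big_nat [leRHS]big_nat ler_sum// => n /andP[Nn _].
have n0 : (0 : R) < n%:R by rewrite ltr0n (leq_trans N0).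
rewrite -natr1 -subr_ge0.
have -> : n%:R^-1 - (n%:R + 1)^-1 - (n%:R + 1) ^- 2 =
    (n%:R * (n%:R + 1) ^+ 2)^-1 :> R.
  by field; rewrite !gt_eqF// addr_gt0.
by rewrite invr_ge0 mulr_ge0 ?sqr_ge0// ltW.
Qed.

End Kernel.

(** * Second differences along the orbit of an isometry *)

Lemma real_inv_nat_small (R : realType) (c e : R) : 0 <= c -> 0 < e ->
  exists N0 : nat, forall N, (N0 <= N)%N -> (0 < N)%N /\ c / N%:R <= e.
Proof.
move=> c0 e0; have := archi_boundP (divr_ge0 c0 (ltW e0)).
set M := Num.bound _ => hM; exists M.+1 => N MN.
have N0 : (0 < N)%N by exact: leq_trans MN.
split=> //; rewrite ler_pdivrMr ?ltr0n// mulrC -ler_pdivrMr//.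
by rewrite (le_trans (ltW hM))// ler_nat ltnW.
Qed.

(** A sequence that is Cauchy with rate [c / N] has a limit, approached at the
    same rate. *)
Lemma limit_of_rate (R : realType) (u : nat -> R) (c : R) : 0 <= c ->
  (forall N M, (0 < N)%N -> (N <= M)%N -> `|u M - u N| <= c / N%:R) ->
  exists l, forall N, (0 < N)%N -> `|l - u N| <= c / N%:R.
Proof.
move=> c0 uc.
have c0N N : 0 <= c / (N%:R : R) by rewrite divr_ge0.
pose A := [set u N - c / N%:R | N in [set N | (0 < N)%N]].
have ubA M : (0 < M)%N -> ubound A (u M + c / M%:R).
  move=> M0 _ [N /= N0 <-]; have [NM|/ltnW MN] := leqP N M.
    by have := uc N M N0 NM; rewrite ler_norml; have := c0N M; lra.
  by have := uc M N M0 MN; rewrite ler_norml; have := c0N N; lra.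
exists (sup A) => N N0; rewrite ler_norml.
have A1 : u N - c / N%:R <= sup A.
  by apply: ub_le_sup; [exists (u N + c / N%:R); exact: ubA|exists N].
have A2 : sup A <= u N + c / N%:R.
  by apply: ge_sup; [exists (u N - c / N%:R); exists N|exact: ubA].
by lra.
Qed.

Section RiemannFunction.
Context {R : realType} {Y : normedModType R[i]}.
Variables (T T' : {linear Y -> Y}).
Hypothesis T_isometry : forall y, rnorm (T y) = rnorm y.
Hypothesis T'_isometry : forall y, rnorm (T' y) = rnorm y.
Hypothesis TK : cancel T T'.
Implicit Types (t h : R) (y p q : Y).

Lemma iter_linear (f : {linear Y -> Y}) n : linear (iter n f).
Proof.
by elim: n => [//|n IH] a x y; rewrite !iterS IH linearP.
Qed.

Lemma rnorm_iter (f : Y -> Y) n y : (forall z, rnorm (f z) = rnorm z) ->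
  rnorm (iter n f y) = rnorm y.
Proof. by move=> fI; elim: n => [//|n IH]; rewrite iterS fI. Qed.

(** The two terms of frequency [n] in the formal trigonometric series of the
    orbit of [y]. *)
Definition harmonic t n y : Y :=
  cis (- (n%:R * t)) *: iter n T y + cis (n%:R * t) *: iter n T' y.

Lemma harmonic_linear t n : linear (harmonic t n).
Proof.
move=> a x y; rewrite /harmonic (iter_linear T) (iter_linear T').
rewrite !scalerDr !scalerA addrACA; congr (_ + _).
by rewrite [in RHS]mulrC [X in _ = _ *: _ + X *: _]mulrC.
Qed.

Lemma rnorm_harmonic t n y : rnorm (harmonic t n y) <= 2 * rnorm y.
Proof.
rewrite (le_trans (rnormD _ _))// !rnormZ !cabs_cis !mul1r.
by rewrite !rnorm_iter//; lra.
Qed.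

(** The [N]-th partial sum of the second difference, at [t] and with step [h],
    of the Riemann function of the orbit of [y]. *)
Definition second_diff N h t y : Y :=
  (h ^+ 2)%:C *: y + \sum_(n < N) (tent h n.+1%:R)%:C *: harmonic t n.+1 y.

Lemma second_diffB N h t x y :
  second_diff N h t (x - y) = second_diff N h t x - second_diff N h t y.
Proof.
rewrite /second_diff scalerBr opprD addrACA; congr (_ + _).
rewrite -sumrB; apply: eq_bigr => n _; rewrite -scalerBr; congr (_ *: _).
have -> : x - y = -1 *: y + x by rewrite scaleN1r addrC.
by rewrite harmonic_linear scaleN1r addrC.
Qed.

Lemma rnorm_second_diff N h t y : 0 < h ->
  rnorm (second_diff N h t y) <= (h ^+ 2 + 18 * h) * rnorm y.
Proof.
move=> h0; rewrite (le_trans (rnormD _ _))// mulrDl lerD//.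
  by rewrite rnormZ cabs_real ger0_norm ?sqr_ge0.
rewrite (le_trans (rnorm_sum _ _ _))//.
rewrite (le_trans (y := \sum_(n < N) tent h n.+1%:R * (2 * rnorm y)))//.
  apply: ler_sum => n _; rewrite rnormZ cabs_real ger0_norm ?tent_ge0//.
  by rewrite ler_wpM2l ?tent_ge0 ?rnorm_harmonic.
rewrite -mulr_suml mulrA ler_wpM2r ?rnorm_ge0//.
have -> : 18 * h = 9 * h * 2 by ring.
rewrite ler_wpM2r//.
apply: (@sum_tent_like _ (fun n => tent h n.+1%:R)) => // n _; split.
  exact: tent_le_sqr.
by apply: tent_decay; rewrite pnatr_eq0.
Qed.

(** Summation by parts on a coboundary [p - cis (- t) *: T p]. *)
Lemma second_diff_coboundary N h t p :
  second_diff N h t (p - cis (- t) *: T p) =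
  \sum_(n < N) (tent h n.+1%:R - tent h n%:R)%:C *:
     (cis (- (n.+1%:R * t)) *: iter n.+1 T p - cis (n%:R * t) *: iter n T' p)
  + (tent h N%:R)%:C *:
     (cis (N%:R * t) *: iter N T' p
      - cis (- (N.+1%:R * t)) *: iter N.+1 T p).
Proof.
pose V n := cis (- (n%:R * t)) *: iter n T p.
pose V' n := cis (n%:R * t) *: iter n T' p.
have hV n : harmonic t n.+1 (p - cis (- t) *: T p) =
    V n.+1 - V n.+2 + (V' n.+1 - V' n).
  have -> : p - cis (- t) *: T p = - cis (- t) *: T p + p.
    by rewrite scaleNr addrC.
  rewrite harmonic_linear /harmonic /V /V'.
  rewrite -iterSr [iter n.+1 T' (T p)]iterSr TK scaleNr scalerDr !scalerA -!cisD.
  have -> : - t - n.+1%:R * t = - (n.+2%:R * t) by rewrite -[n.+2%:R]natr1; ring.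
  have -> : - t + n.+1%:R * t = n%:R * t by rewrite -natr1; ring.
  by rewrite opprD addrC addrACA.
rewrite /second_diff; under eq_bigr do rewrite hV.
have -> : h ^+ 2 = tent h 0%:R by rewrite /tent eqxx.
have -> : p - cis (- t) *: T p = V' 0%N - V 1%N.
  by rewrite /V /V' !mul0r cis0 scale1r mul1r.
rewrite -!/(V _) -!/(V' _).
under [in RHS]eq_bigr do rewrite -/(V _) -/(V' _).
elim: N => [|N IH]; first by rewrite !big_ord0 addr0 add0r.
rewrite !big_ord_recr/= addrA IH -addrA -[RHS]addrA; congr (_ + _).
have parts (a b : R[i]) (x y z w : Y) :
    a *: (x - y) + b *: (y - z + (w - x)) = (b - a) *: (y - x) + b *: (w - z).
  have -> : y - z + (w - x) = (y - x) + (w - z).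
    by rewrite addrACA [RHS]addrACA; congr (_ + _); exact: addrC.
  by rewrite -(opprB y x) scalerN scalerBl (scalerDr b (y - x)) addrA
    (addrC (- _)).
by rewrite realCB; exact: parts.
Qed.


(** The second difference is [o(h)] at the angles [t] for which [q] is in the
    closed range of [1 - cis (- t) *: T]: the general bound, of order [h], is
    used on the small remainder, and summation by parts on the coboundary. *)
Lemma second_diff_little_o t q :
  (forall e, 0 < e -> exists p, rnorm (q - (p - cis (- t) *: T p)) <= e) ->
  forall e, 0 < e -> exists2 d, 0 < d & forall h, 0 < h < d ->
  exists N0, forall N, (N0 <= N)%N -> rnorm (second_diff N h t q) <= e * h.
Proof.
move=> qcl e e0.
have e'0 : 0 < e / 76 by rewrite divr_gt0.
have [p pq] := qcl _ e'0.
pose P := rnorm p + 1.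
have P0 : 0 < P by rewrite ltr_wpDl ?rnorm_ge0.
pose k := Num.min 1 (e / (160 * P)).
have k0 : 0 < k by rewrite lt_min ltr01/= divr_gt0// mulr_gt0 ?ltr0n.
have k1 : k <= 1 by rewrite ge_min lexx.
have kP : 160 * k * P <= e.
  rewrite mulrAC -ler_pdivlMl ?mulr_gt0// mulrC.
  by rewrite ge_min lexx orbT.
exists (k ^+ 2); first by rewrite exprn_gt0.
move=> h /andP[h0 hk].
have h1 : h <= 1 by rewrite (le_trans (ltW hk))// expr_le1// ltW.
have eh0 : 0 < e * h / 4 by rewrite divr_gt0// mulr_gt0.
have P80 : 0 <= 8 * P by rewrite mulr_ge0// ltW.
have [N0 N0P] := real_inv_nat_small P80 eh0.
exists N0 => N /N0P[Npos NP].
rewrite (le_trans (rnorm_le_add _ (second_diff N h t (p - cis (- t) *: T p))))//.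
rewrite -second_diffB.
have {}pq : rnorm (second_diff N h t (q - (p - cis (- t) *: T p))) <= e * h / 4.
  rewrite (le_trans (rnorm_second_diff _ _ _ h0))//.
  have -> : e * h / 4 = (h + 18 * h) * (e / 76) by field.
  rewrite ler_pM ?rnorm_ge0// ?lerD2r; last by rewrite expr2 ler_piMl// ltW.
  by rewrite addr_ge0 ?sqr_ge0// mulr_ge0// ltW.
suff : rnorm (second_diff N h t (p - cis (- t) *: T p)) <= e * h / 2 by lra.
rewrite second_diff_coboundary (le_trans (rnormD _ _))//.
have bnd m n (c : R) : rnorm (c%:C *: (cis (- (m%:R * t)) *: iter m T p
    - cis (n%:R * t) *: iter n T' p)) <= `|c| * (2 * P).
  rewrite rnormZ cabs_real ler_wpM2l// (le_trans (rnormB _ _))//.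
  by rewrite !rnormZ !cabs_cis !mul1r !rnorm_iter// /P; have := rnorm_ge0 p; lra.
have last_le : rnorm ((tent h N%:R)%:C *:
     (cis (N%:R * t) *: iter N T' p
      - cis (- (N.+1%:R * t)) *: iter N.+1 T p)) <= e * h / 4.
  rewrite -opprB scalerN rnormN (le_trans (bnd _ _ _))// (le_trans _ NP)//.
  rewrite ger0_norm ?tent_ge0//.
  have -> : 8 * P / N%:R = 4 / N%:R * (2 * P) by ring.
  rewrite ler_wpM2r ?mulr_ge0 ?(ltW P0)//.
  rewrite (le_trans (tent_decay _ _)) ?pnatr_eq0 -?lt0n//.
  rewrite ler_pM2l// lef_pV2 ?posrE ?exprn_gt0 ?ltr0n//.
  by rewrite -natrX ler_nat expnS expn1 leq_pmulr.
have h3 : h ^+ 3 <= (k * h) ^+ 2.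
  by rewrite exprMn exprS ler_wpM2r ?sqr_ge0// ltW.
(* the increments are bounded both by h ^+ 3, hence by (k * h) ^+ 2, and by
   4 / n ^+ 2, so that their sum is of order k * h rather than h *)
have sum_le : \sum_(n < N) `|tent h n.+1%:R - tent h n%:R| <= 10 * k * h.
  have kh0 : 0 < k * h by rewrite mulr_gt0.
  have lip n : `|tent h n.+1%:R - tent h n%:R| <= (k * h) ^+ 2.
    by rewrite -natr1 (le_trans (tent_lip _ (ltW h0))).
  have -> : 10 * k * h = k * h + 9 * (k * h) by ring.
  case: (N) => [|M]; first by rewrite big_ord0; lra.
  rewrite big_ord_recl/= lerD//.
    rewrite (le_trans (lip 0%N))// expr2 ler_piMl ?(ltW kh0)//.
    by rewrite mulr_ile1 ?(ltW k0) ?(ltW h0).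
  apply: (@sum_tent_like _
    (fun n => `|tent h n.+2%:R - tent h n.+1%:R|)) => // n _.
  split; first exact: lip.
  have mono m : (0 < m)%N -> 4 / (m.+1%:R : R) ^+ 2 <= 4 / m%:R ^+ 2.
    move=> m0; rewrite ler_pM2l// lef_pV2 ?posrE ?exprn_gt0 ?ltr0n//.
    by rewrite ler_pXn2r ?nnegrE// ler_nat.
  have d1 : tent h n.+1%:R <= 4 / n.+1%:R ^+ 2 by rewrite tent_decay ?pnatr_eq0.
  have d2 : tent h n.+2%:R <= 4 / n.+2%:R ^+ 2 by rewrite tent_decay ?pnatr_eq0.
  have {}d2 := le_trans d2 (mono _ (ltn0Sn n)).
  rewrite ler_norml lerBlDr lerBrDr (le_trans d2) ?lerDl ?tent_ge0// andbT.
  by rewrite addrC (le_trans _ (tent_ge0 _ _))// subr_le0.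
have -> : e * h / 2 = e * h / 4 + e * h / 4 by field.
rewrite lerD// (le_trans (rnorm_sum _ _ _))//.
rewrite (le_trans (y := 10 * k * h * (2 * P)))//; last first.
  have -> : 10 * k * h * (2 * P) = 160 * k * P * (h / 8) by field.
  have -> : e * h / 4 = e * (h / 4) by rewrite mulrA.
  by rewrite ler_pM ?mulr_ge0 ?(ltW k0) ?(ltW P0) ?(ltW h0)//; lra.
rewrite (le_trans
  (y := (\sum_(n < N) `|tent h n.+1%:R - tent h n%:R|) * (2 * P)))//.
  by rewrite mulr_suml ler_sum// => n _; exact: bnd.
by rewrite ler_wpM2r// mulr_ge0// ltW.
Qed.

End RiemannFunction.

(** * The Riemann function and countable spectrum *)

(** An angle between [- 2 * pi] and [2 * pi] is determined by its cosine, its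
    sign and its position with respect to [- pi] and [pi]. *)
Lemma countable_angles (R : realType) (E : set R[i]) : countable E ->
  countable [set t : R | `|t| <= 2 * pi /\ E (cis t)].
Proof.
move=> Ec.
have Bc : countable (E `*` [set: bool * bool]).
  by apply: countableX => //; exact: countableP.
apply: (@countable_inj_into _ _ _ _
    (fun t : R => (cis t, (0 <= t, `|t| <= pi))) _ _ Bc); last first.
  by move=> t [_ Et]; split.
move=> t u /set_mem[t2 _] /set_mem[u2 _] [] ctu _ tu0 tupi.
have {}ctu : cos `|t| = cos `|u| by rewrite !cos_norm.
suff tu : `|t| = `|u|.
  move: tu0; have [t0|t0] := leP 0 t; have [u0|u0] := leP 0 u => // _.
    by move: tu; rewrite !ger0_norm.
  by move: tu; rewrite !ltr0_norm// => /oppr_inj.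
move: tupi t2 u2 ctu; have := normr_ge0 t; have := normr_ge0 u.
move: `|t| `|u| => a b b0 a0.
have [api|api] := leP a pi; have [bpi|bpi] := leP b pi => // _ a2 b2 ctu.
  by apply: cos_inj => //; rewrite in_itv/= ?a0 ?b0.
have cN v : cos (2 * pi - v) = cos v :> R.
  by rewrite -[RHS]cosN -(cosD2pi (- v)) addrC -[pi *+ 2]mulr_natl.
have : 2 * pi - a = 2 * pi - b.
  by apply: cos_inj; rewrite ?in_itv/= ?cN//; lra.
by lra.
Qed.

Lemma cis_second_diff (R : realType) (a b : R) :
  (1 - cis (a + b)) + (1 - cis (a - b)) - 2 * (1 - cis a) =
  (2 - 2 * cos b)%:C * cis a.
Proof.
rewrite -one_sub_cis !cisD.
have := cisNK b; set c := cis b; set c' := cis (- b) => cK.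
have -> : (1 - c) * (1 - c') = 2 - c - c'.
  by rewrite mulrBl mul1r mulrBr mulr1 (mulrC c) cK; ring.
by ring.
Qed.

Section CountableSpectrum.
Context {R : realType} {Y : normedModType R[i]}.
Variables (T T' : {linear Y -> Y}).
Hypothesis T_isometry : forall y, rnorm (T y) = rnorm y.
Hypothesis T'_isometry : forall y, rnorm (T' y) = rnorm y.
Hypothesis TK : cancel T T'.
Variable q : Y.
Implicit Types (t h : R).

(** The [N]-th partial sum of the Riemann function of the orbit of [q], the
    series integrated twice, normalized so as to vanish at [2 * pi] and
    [- 2 * pi]. *)
Definition riemann_fun N t : Y :=
  (t ^+ 2 / 2 - 2 * pi ^+ 2)%:C *: q +
  \sum_(n < N) (n.+1%:R ^- 2)%:C *:
    ((1 - cis (- (n.+1%:R * t))) *: iter n.+1 T q +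
     (1 - cis (n.+1%:R * t)) *: iter n.+1 T' q).

Lemma riemann_fun_second_diff N h t :
  riemann_fun N (t + h) + riemann_fun N (t - h) - 2 *: riemann_fun N t =
  second_diff T T' N h t q.
Proof.
have split3 (a b c d e f : Y) :
    (a + b) + (c + d) - 2 *: (e + f) = (a + c - 2 *: e) + (b + d - 2 *: f).
  by rewrite scalerDr (addrACA a) opprD [LHS]addrACA.
rewrite /riemann_fun /second_diff split3; congr (_ + _).
  rewrite -scalerDl scalerA -scalerBl; congr (_ *: _).
  rewrite -(@realC_nat R 2) -realCD -realCM -realCB.
  by congr (_%:C); field.
rewrite scaler_sumr -sumrN -!big_split/=; apply: eq_bigr => n _.
rewrite /harmonic; set A := iter _ T q; set B := iter _ T' q.
have tE : tent h n.+1%:R = n.+1%:R ^- 2 * (2 - 2 * cos (n.+1%:R * h)).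
  by rewrite /tent pnatr_eq0 mulrC.
have coefE u : (n.+1%:R ^- 2)%:C * (1 - cis (u + n.+1%:R * h))
    + (n.+1%:R ^- 2)%:C * (1 - cis (u - n.+1%:R * h))
    - 2 * ((n.+1%:R ^- 2)%:C * (1 - cis u)) = (tent h n.+1%:R)%:C * cis u.
  by rewrite tE realCM -mulrA -cis_second_diff; ring.
rewrite !scalerDr !scalerA opprD [X in X + (_ + _)]addrACA addrACA.
rewrite -!scalerDl -!scalerBl; congr (_ *: _ + _ *: _).
  rewrite -coefE (addrC (_ * (1 - cis (- (n.+1%:R * t) + _)))).
  by congr (_ * (1 - cis _) + _ * (1 - cis _) - _); ring.
by rewrite -coefE; congr (_ * (1 - cis _) + _ * (1 - cis _) - _); ring.
Qed.

Lemma riemann_fun_ends N t : cis t = 1 -> t ^+ 2 = 4 * pi ^+ 2 ->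
  riemann_fun N t = 0.
Proof.
move=> ct1 t2; rewrite /riemann_fun t2.
have -> : 4 * pi ^+ 2 / 2 - 2 * pi ^+ 2 = 0 :> R by field.
rewrite scale0r add0r big1// => n _.
have cn (m : nat) : cis (m%:R * t) = 1.
  by rewrite mulr_natl cisMn ct1 expr1n.
have cnN (m : nat) : cis (- (m%:R * t)) = 1.
  by rewrite -[LHS]mulr1 -[X in _ * X](cn m) cisNK.
by rewrite cn cnN subrr !scale0r addr0 scaler0.
Qed.

Lemma riemann_fun0 N : riemann_fun N 0 = (- (2 * pi ^+ 2))%:C *: q.
Proof.
rewrite /riemann_fun expr0n/= mul0r sub0r big1 ?addr0// => n _.
by rewrite mulr0 oppr0 cis0 subrr !scale0r addr0 scaler0.
Qed.

Lemma riemann_fun_cauchy t N M : (0 < N)%N -> (N <= M)%N ->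
  rnorm (riemann_fun M t - riemann_fun N t) <= 4 * rnorm q / N%:R.
Proof.
move=> N0 NM; pose F n := (n.+1%:R ^- 2)%:C *:
    ((1 - cis (- (n.+1%:R * t))) *: iter n.+1 T q +
     (1 - cis (n.+1%:R * t)) *: iter n.+1 T' q).
have -> : riemann_fun M t - riemann_fun N t = \sum_(N <= n < M) F n.
  rewrite /riemann_fun opprD addrACA subrr add0r -/(F _).
  rewrite -!(big_mkord xpredT F) (big_cat_nat (n := N))//=.
  by rewrite addrAC subrr add0r.
rewrite (le_trans (rnorm_sum _ _ _))//.
rewrite (le_trans (y := \sum_(N <= n < M) (4 * rnorm q) * n.+1%:R ^- 2))//.
  rewrite ler_sum// => n _; rewrite /F rnormZ cabs_real ger0_norm; last first.
    by rewrite invr_ge0 sqr_ge0.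
  rewrite mulrC ler_wpM2r ?invr_ge0 ?sqr_ge0// (le_trans (rnormD _ _))//.
  rewrite !rnormZ !rnorm_iter//.
  have c2 (u : R) : cabs (1 - cis u) <= 2.
    rewrite (le_trans (rnormB (_ : R[i]^o) _))// cabs_cis.
    by rewrite -cis0 cabs_cis.
  have := ler_wpM2r (rnorm_ge0 q) (c2 (n.+1%:R * t)).
  have := ler_wpM2r (rnorm_ge0 q) (c2 (- (n.+1%:R * t))).
  by lra.
rewrite -mulr_sumr ler_wpM2l ?mulr_ge0 ?rnorm_ge0//.
exact: sum_inv_sqr.
Qed.

Lemma riemann_fun_lip N t u :
  rnorm (riemann_fun N t - riemann_fun N u) <=
  (`|t + u| * rnorm q + N%:R * (2 * rnorm q)) * `|t - u|.
Proof.
rewrite /riemann_fun opprD addrACA -scalerBl -sumrB.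
rewrite (le_trans (rnormD _ _))// [leRHS]mulrDl lerD//.
  rewrite rnormZ -realCB cabs_real [leRHS]mulrAC ler_wpM2r ?rnorm_ge0//.
  have -> : t ^+ 2 / 2 - 2 * pi ^+ 2 - (u ^+ 2 / 2 - 2 * pi ^+ 2) =
      (t + u) * (t - u) / 2 by field.
  rewrite normrM (normrM (t + u)) ler_piMr ?mulr_ge0//.
  by rewrite ger0_norm// invf_le1// ler1n.
rewrite (le_trans (rnorm_sum _ _ _))//.
rewrite (le_trans (y := \sum_(n < N) 2 * rnorm q * `|t - u|))//; last first.
  by rewrite sumr_const card_ord -[_ *+ N]mulr_natl !mulrA.
apply: ler_sum => n _; rewrite -scalerBr opprD addrACA -!scalerBl.
have cl (v w : R) : cabs ((1 - cis v) - (1 - cis w)) <= `|v - w|.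
  have -> : (1 - cis v) - (1 - cis w) = cis w * (1 - cis (v - w)).
    by rewrite mulrBr mulr1 -cisD (addrC w) subrK; ring.
  by rewrite cabsM cabs_cis mul1r cabs_one_sub_cis.
rewrite rnormZ cabs_real ger0_norm ?invr_ge0 ?sqr_ge0//.
have n1 : 1 <= (n.+1%:R : R) by rewrite ler1n.
have n0 : 0 < (n.+1%:R : R) by rewrite ltr0n.
rewrite ler_pdivrMl ?exprn_gt0// (le_trans (rnormD _ _))//.
rewrite !rnormZ !rnorm_iter// -mulrDl.
rewrite [leRHS](_ : _ = n.+1%:R ^+ 2 * (2 * `|t - u|) * rnorm q); last by ring.
rewrite ler_wpM2r ?rnorm_ge0//.
rewrite (le_trans (lerD (cl _ _) (cl _ _)))//.
have -> : - (n.+1%:R * t) - - (n.+1%:R * u) = - (n.+1%:R * (t - u)) by ring.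
rewrite normrN -mulrBr normrM gtr0_norm//.
have : n.+1%:R * `|t - u| <= n.+1%:R ^+ 2 * `|t - u|.
  by rewrite ler_wpM2r// expr2 ler_peMl// ltW.
by lra.
Qed.

(** If the orbit of [q] under an isometry has its spectrum in a countable set
    [E] of the circle, expressed by the decay of the second differences of the
    Riemann function off [E], and no eigenvector component at the points of [E],
    expressed by closed ranges, then [q] vanishes. The Riemann function itself
    need not exist when [Y] is not complete, but the norms of its partial sums
    have a limit, the real function [g] of the proof. *)
Theorem countable_spectrum (E : set R[i]) :
  countable E ->
  (forall t, ~ E (cis t) -> forall e, 0 < e -> exists2 d, 0 < d &
     forall h, 0 < h < d -> exists N0, forall N, (N0 <= N)%N ->
     rnorm (second_diff T T' N h t q) <= e * h ^+ 2) ->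
  (forall t, E (cis t) -> forall e, 0 < e ->
     exists p, rnorm (q - (p - cis (- t) *: T p)) <= e) ->
  q = 0.
Proof.
move=> Ec Ereg Eex.
pose c := 4 * rnorm q.
have c0 : 0 <= c by rewrite mulr_ge0 ?rnorm_ge0.
have /choice[g gP] : forall t, exists l, forall N, (0 < N)%N ->
    `|l - rnorm (riemann_fun N t)| <= c / N%:R.
  move=> t; apply: limit_of_rate => // N M N0 NM.
  by rewrite (le_trans (rnorm_dist _ _))// riemann_fun_cauchy.
have gE t r : (forall N, rnorm (riemann_fun N t) = r) -> g t = r.
  move=> rE; apply/eqP; rewrite -subr_eq0 -normr_le0.
  apply/ler_addgt0Pr => e e0; have [N0 N0P] := real_inv_nat_small c0 e0.
  have [Npos Ne] := N0P N0 (leqnn _).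
  by rewrite add0r -(rE N0) (le_trans (gP _ _ Npos)).
have gc : continuous g.
  move=> t; apply/cvgrPdist_le => e e0.
  have e30 : 0 < e / 3 by rewrite divr_gt0.
  have [N0 N0P] := real_inv_nat_small c0 e30.
  have [Npos Ne] := N0P N0 (leqnn _).
  pose L := (2 * `|t| + 1) * rnorm q + N0%:R * (2 * rnorm q) + 1.
  have L0 : 0 < L.
    by rewrite ltr_wpDl// addr_ge0 ?mulr_ge0 ?addr_ge0 ?mulr_ge0 ?rnorm_ge0.
  apply/nbhs_ballP; exists (Num.min 1 (e / 3 / L)) => /=.
    by rewrite lt_min ltr01 divr_gt0.
  move=> u; rewrite /ball/= lt_min => /andP[tu1 tuL].
  have tu : `|t + u| <= 2 * `|t| + 1.
    have -> : t + u = t + t - (t - u) by ring.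
    rewrite (le_trans (ler_normB _ _))// lerD ?(ltW tu1)//.
    by rewrite (le_trans (ler_normD _ _))//; lra.
  have : rnorm (riemann_fun N0 t - riemann_fun N0 u) <= e / 3.
    rewrite (le_trans (riemann_fun_lip _ _ _))//.
    rewrite (le_trans (y := L * (e / 3 / L)))//; last first.
      by rewrite mulrC divfK ?gt_eqF.
    rewrite ler_pM ?(ltW tuL)//.
      by rewrite addr_ge0 ?mulr_ge0 ?rnorm_ge0.
    rewrite -[leLHS]addr0 lerD// lerD2r.
    by rewrite ler_wpM2r ?rnorm_ge0.
  have := gP t N0 Npos; have := gP u N0 Npos.
  have := rnorm_dist (riemann_fun N0 t) (riemann_fun N0 u).
  by rewrite !ler_norml; lra.
have step t h B : (exists N0, forall N, (N0 <= N)%N ->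
    rnorm (second_diff T T' N h t q) <= B) ->
    - B <= g (t + h) + g (t - h) - 2 * g t.
  move=> [N0 N0P]; apply/ler_addgt0Pr => e e0.
  have e40 : 0 < e / 4 by rewrite divr_gt0.
  have [N1 N1P] := real_inv_nat_small c0 e40.
  pose N := maxn N0 N1.
  have [Npos Ne] := N1P N (leq_maxr _ _).
  have NB := N0P N (leq_maxl _ _).
  have := gP (t + h) N Npos; have := gP (t - h) N Npos; have := gP t N Npos.
  have : 2 * rnorm (riemann_fun N t) <= rnorm (riemann_fun N (t + h)) +
      rnorm (riemann_fun N (t - h)) + B.
    rewrite -riemann_fun_second_diff in NB.
    have -> : 2 * rnorm (riemann_fun N t) = rnorm (2 *: riemann_fun N t).
      by rewrite rnormZ -(@realC_nat R 2) cabs_real ger0_norm.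
    rewrite (le_trans (rnorm_le_add _
      (riemann_fun N (t + h) + riemann_fun N (t - h))))//.
    by rewrite rnorm_distC lerD// rnormD.
  by rewrite !ler_norml; lra.
have pi0 := pi_gt0 R.
have g0 : g 0 = 2 * pi ^+ 2 * rnorm q.
  apply: gE => N; rewrite riemann_fun0 rnormZ cabs_real normrN ger0_norm//.
  by rewrite mulr_ge0 ?sqr_ge0.
have c2pi : cis (2 * pi) = 1 :> R[i].
  by rewrite /cis mulr_natl cos2pi sin2pi.
have gb : g (2 * pi) = 0.
  by apply: gE => N; rewrite riemann_fun_ends ?rnorm0//; ring.
have ga : g (- (2 * pi)) = 0.
  apply: gE => N; rewrite riemann_fun_ends ?rnorm0//; last by ring.
  by rewrite -[LHS]mulr1 -[X in _ * X]c2pi cisNK.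
have ab : - (2 * pi) < 2 * pi :> R by lra.
suff : g 0 <= 0.
  rewrite g0 pmulr_rle0 ?mulr_gt0 ?exprn_gt0// => q0.
  by apply: rnorm0_eq0; apply/eqP; rewrite eq_le q0 rnorm_ge0.
apply: (schwarz_nonpos ab gc _ _ (countable_angles Ec)).
- by rewrite ga.
- by rewrite gb.
- move=> t tab nC e e0.
  have nE : ~ E (cis t).
    move=> Et; apply: nC; split=> //.
    by rewrite ler_norml !ltW//; case/andP: tab.
  have [d d0 dP] := Ereg t nE e e0; exists d => // h hd.
  exact: step (dP h hd).
- move=> t tab [_ Et] e e0.
  have [d d0 dP] := second_diff_little_o T_isometry T'_isometry TK (Eex t Et) e0.
  by exists d => // h hd; exact: step (dP h hd).
- by lra.
Qed.

End CountableSpectrum.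

(** * Localization of the second differences *)

Section LocalEstimate.
Context {R : realType} {W : normedModType R[i]}.
Implicit Types (s t h b : R) (x : nat -> W).

(** The [J]-th partial sum of the Z-transform of [x] at the point of modulus
    [s] and angle [t]. *)
Definition zpartial x J s t : W :=
  \sum_(j < J) ((s ^- j)%:C * cis (- (j%:R * t))) *: x j.

(** The second difference applied to the translates of [x], evaluated at index
    [m]; because of the truncated subtraction it is meant for [N <= m]. *)
Definition window x N h t m : W :=
  (h ^+ 2)%:C *: x m + \sum_(n < N) (tent h n.+1%:R)%:C *:
    (cis (- (n.+1%:R * t)) *: x (m + n.+1)%N
     + cis (n.+1%:R * t) *: x (m - n.+1)%N).

(** The same sum over all the indices below [J], up to a unimodular factor; see
    [tent_seriesE]. *)
Definition tent_series x J h t m : W :=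
  \sum_(j < J) (tent h (j%:R - m%:R))%:C *: (cis (- (j%:R * t)) *: x j).

(** Localization: replacing [tent] by the Riemann sums [tent_sum] turns the sum
    into an average of values of the transform at angles within [h] of [t], with
    weights of total mass at most [h ^+ 2]. *)
Lemma tent_series_le x J h t m b : 0 <= h -> 0 <= b ->
  (forall u, `|u - t| <= h -> rnorm (zpartial x J 1 u) <= b) ->
  rnorm (tent_series x J h t m) <= h ^+ 2 * b.
Proof.
move=> h0 b0 xb; apply/ler_addgt0Pr => e e0.
pose D := \sum_(j < J) h ^+ 2 * ((j%:R - m%:R) * h) ^+ 2 / 4 * rnorm (x j).
have D0 : 0 <= D.
  apply: sumr_ge0 => j _.
  by rewrite mulr_ge0 ?rnorm_ge0// divr_ge0// mulr_ge0// sqr_ge0.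
have [M0 M0P] := real_inv_nat_small D0 e0.
have [Mpos Me] := M0P M0 (leqnn _); set M := M0 in Mpos Me.
have Mr : 0 < (M%:R : R) by rewrite ltr0n.
pose d := h / M%:R.
have d0 : 0 <= d by rewrite divr_ge0.
have hE : M%:R * d = h by rewrite /d mulrC divfK// gt_eqF.
pose S := \sum_(j < J) tent_sum d M (j%:R - m%:R) *: (cis (- (j%:R * t)) *: x j).
have SE : S = (d ^+ 2)%:C *: \sum_(k < M) \sum_(l < M)
    cis (- (m%:R * ((k%:R - l%:R) * d))) *:
    zpartial x J 1 (t - (k%:R - l%:R) * d).
  transitivity (\sum_(j < J) \sum_(k < M) \sum_(l < M) (d ^+ 2)%:C *:
    (cis (- (m%:R * ((k%:R - l%:R) * d))) *:
     ((((1 : R) ^- j)%:C * cis (- (j%:R * (t - (k%:R - l%:R) * d)))) *: x j))).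
    apply: eq_bigr => j _; rewrite /tent_sum mulr_sumr scaler_suml.
    apply: eq_bigr => k _; rewrite mulr_sumr scaler_suml.
    apply: eq_bigr => l _; rewrite !scalerA expr1n invr1 mul1r -!mulrA -!cisD.
    by congr ((_ * cis _) *: _); ring.
  rewrite exchange_big scaler_sumr/=; apply: eq_bigr => k _.
  rewrite exchange_big scaler_sumr/=; apply: eq_bigr => l _.
  by rewrite /zpartial !scaler_sumr.
have Sb : rnorm S <= h ^+ 2 * b.
  rewrite SE rnormZ cabs_real ger0_norm ?sqr_ge0//.
  have -> : h ^+ 2 * b = d ^+ 2 * \sum_(k < M) \sum_(l < M) b.
    rewrite !sumr_const !card_ord -mulrnA -[_ *+ (M * M)]mulr_natr natrM -hE.
    by ring.
  rewrite ler_wpM2l ?sqr_ge0// (le_trans (rnorm_sum _ _ _))// ler_sum// => k _.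
  rewrite (le_trans (rnorm_sum _ _ _))// ler_sum// => l _.
  rewrite rnormZ cabs_cis mul1r xb// addrAC subrr sub0r normrN normrM.
  rewrite (ger0_norm d0) -[leRHS]hE ler_wpM2r//.
  have /andP[k0 kM] : 0 <= (k%:R : R) <= M%:R by rewrite ler0n ler_nat ltnW.
  have /andP[l0 lM] : 0 <= (l%:R : R) <= M%:R by rewrite ler0n ler_nat ltnW.
  by rewrite ler_norml; lra.
rewrite (le_trans (rnorm_le_add _ S))// lerD// (le_trans _ Me)//.
rewrite /tent_series /S -sumrB (le_trans (rnorm_sum _ _ _))//.
rewrite /D mulr_suml ler_sum// => j _.
rewrite -scalerBl rnormZ rnormZ cabs_cis mul1r.
rewrite [leRHS]mulrAC ler_wpM2r ?rnorm_ge0// rnorm_distC.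
rewrite -{1}hE (le_trans (tent_sum_approx _ _ _))// hE.
set v := j%:R - m%:R.
have -> : h ^+ 2 * (v * d) ^+ 2 / 4 = h ^+ 2 * (v * h) ^+ 2 / 4 / M%:R / M%:R.
  by rewrite /d; field; rewrite gt_eqF.
rewrite ler_piMr//; last by rewrite invf_le1// ler1n.
by rewrite divr_ge0// divr_ge0// mulr_ge0 ?sqr_ge0.
Qed.

Lemma tent_seriesE x h t m K :
  cis (m%:R * t) *: tent_series x (m + K.+1) h t m =
  (h ^+ 2)%:C *: x m +
  (\sum_(0 <= n < K) (tent h n.+1%:R)%:C *:
      (cis (- (n.+1%:R * t)) *: x (m + n.+1)%N) +
   \sum_(0 <= n < m) (tent h n.+1%:R)%:C *:
      (cis (n.+1%:R * t) *: x (m - n.+1)%N)).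
Proof.
rewrite /tent_series big_split_ord/= big_ord_recl/= addn0 subrr {2}/tent eqxx.
rewrite !scalerDr addrC -addrA; congr (_ + (_ + _)).
- by rewrite !scalerA mulrAC -cisD subrr cis0 mul1r.
- rewrite scaler_sumr big_mkord; apply: eq_bigr => n _.
  rewrite /bump/= add1n natrD addrAC subrr add0r !scalerA.
  rewrite mulrAC -cisD mulrC; congr ((_ * cis _) *: _).
  by ring.
rewrite scaler_sumr big_mkord (reindex_inj rev_ord_inj)/=; apply: eq_bigr => n _.
rewrite natrB// !scalerA addrAC subrr add0r tentN mulrAC -cisD mulrC.
by congr ((_ * cis _) *: _); ring.
Qed.

Lemma tent_tail (y : nat -> W) (c : nat -> R) h N K B : (0 < N)%N -> 0 <= B ->
  (forall n, rnorm (y n) <= B) ->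
  rnorm (\sum_(N <= n < K) (tent h n.+1%:R)%:C *: (cis (c n) *: y n)) <=
  4 * B / N%:R.
Proof.
move=> N0 B0 yB; rewrite (le_trans (rnorm_sum _ _ _))//.
rewrite (le_trans (y := \sum_(N <= n < K) 4 * B * n.+1%:R ^- 2))//.
  rewrite ler_sum// => n _.
  rewrite rnormZ rnormZ cabs_real cabs_cis mul1r ger0_norm ?tent_ge0//.
  by rewrite mulrAC ler_pM ?tent_ge0 ?rnorm_ge0// tent_decay// pnatr_eq0.
by rewrite -mulr_sumr ler_wpM2l ?mulr_ge0// sum_inv_sqr.
Qed.

Lemma window_le x h t m N b B : 0 <= B -> (forall n, rnorm (x n) <= B) ->
  (0 < N)%N -> (N <= m)%N ->
  (exists J0, forall J, (J0 <= J)%N -> rnorm (tent_series x J h t m) <= b) ->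
  rnorm (window x N h t m) <= b + 8 * B / N%:R.
Proof.
move=> B0 xB N0 Nm [J0 J0P].
pose K := (maxn J0 N).
have JK : (J0 <= m + K.+1)%N.
  apply: leq_trans (leq_maxl J0 N) _; apply: leq_trans (leqnSn _) _.
  exact: leq_addl.
have Sb := J0P _ JK.
have := tent_seriesE x h t m K.
rewrite (big_cat_nat (n := N))//= ?leq_maxr// (big_cat_nat (n := N) (p := m))//=.
rewrite addrACA -big_split/= big_mkord.
set A := \sum_(N <= i < K) _; set C := \sum_(N <= i < m) _.
rewrite (addrA _ _ (A + C)).
have -> : (h ^+ 2)%:C *: x m + \sum_(i < N) ((tent h i.+1%:R)%:C *:
    (cis (- (i.+1%:R * t)) *: x (m + i.+1)%N) +
    (tent h i.+1%:R)%:C *: (cis (i.+1%:R * t) *: x (m - i.+1)%N)) =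
  window x N h t m.
  by rewrite /window; congr (_ + _); apply: eq_bigr => n _; rewrite scalerDr.
move=> /esym/eqP; rewrite -subr_eq0 -addrA addr_eq0 opprB => /eqP ->.
rewrite (le_trans (rnormB _ _))// rnormZ cabs_cis mul1r lerD//.
have -> : 8 * B / N%:R = 4 * B / N%:R + 4 * B / N%:R by ring.
rewrite (le_trans (rnormD _ _))// lerD//; exact: tent_tail.
Qed.

Lemma pow_near1 (e : R) n : 0 <= e -> 0 <= 1 - (1 + e) ^- n <= n%:R * e.
Proof.
move=> e0; have s0 : 0 < 1 + e by rewrite ltr_pwDl.
have p1 m : (1 + e) ^- m <= 1 by rewrite invf_le1 ?exprn_gt0// exprn_ege1// lerDl.
rewrite subr_ge0 p1/=; elim: n => [|n IH].
  by rewrite expr0 invr1 subrr mul0r.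
rewrite -natr1 mulrDl mul1r exprS invfM.
have -> : 1 - (1 + e)^-1 * (1 + e) ^- n =
    (1 - (1 + e) ^- n) + (1 + e) ^- n * (1 - (1 + e)^-1) by ring.
rewrite lerD//.
have e1 : 1 - (1 + e)^-1 <= e.
  rewrite lerBlDr -lerBlDl -(ler_pM2r s0) mulVf ?gt_eqF//.
  by have := sqr_ge0 e; lra.
have e2 : 0 <= 1 - (1 + e)^-1 by have := p1 1%N; rewrite expr1; lra.
by rewrite (le_trans _ e1)// ler_piMl.
Qed.

(** If the transform of [x] is bounded by [b] outside the unit circle near the
    angle [t], the second differences at [t] are at most [h ^+ 2 * b] up to the
    truncation error. The bound is proved for the damped sequences
    [s ^- j *: x j], whose transform on the circle is that of [x] at modulus
    [s], and [s] tends to [1]. *)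
Theorem local_estimate x h t b B s1 : 0 < h -> 0 <= b -> 0 <= B ->
  (forall n, rnorm (x n) <= B) -> 1 < s1 ->
  (forall s, 1 < s < s1 -> forall e, 0 < e -> exists J0, forall J, (J0 <= J)%N ->
     forall u, `|u - t| <= h -> rnorm (zpartial x J s u) <= b + e) ->
  forall m N, (0 < N)%N -> (N <= m)%N ->
  rnorm (window x N h t m) <= h ^+ 2 * b + 8 * B / N%:R.
Proof.
move=> h0 b0 B0 xB s1P hx m N N0 Nm; apply/ler_addgt0Pr => e e0.
have e20 : 0 < e / 2 by rewrite divr_gt0.
pose L := (h ^+ 2 + 18 * h) * ((m + N)%:R * B) + 1.
have L0 : 0 < L.
  by rewrite ltr_wpDl// mulr_ge0// ?mulr_ge0// addr_ge0 ?sqr_ge0// mulr_ge0// ltW.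
pose r := Num.min ((s1 - 1) / 2) (e / 2 / L).
have r0 : 0 < r by rewrite lt_min !divr_gt0// subr_gt0.
have rs : r <= (s1 - 1) / 2 by rewrite ge_min lexx.
have rL : L * r <= e / 2 by rewrite mulrC -ler_pdivlMr// ge_min lexx orbT.
pose s := 1 + r.
have s1s : 1 < s < s1 by rewrite /s; lra.
pose y j := (s ^- j)%:C *: x j.
have p0 j : 0 <= s ^- j <= 1.
  have /andP[p1 _] := pow_near1 j (ltW r0); rewrite -subr_ge0 p1 andbT.
  by rewrite invr_ge0 exprn_ge0// addr_ge0// ltW.
have yB n : rnorm (y n) <= B.
  have /andP[q0 q1] := p0 n.
  rewrite rnormZ cabs_real ger0_norm// (le_trans _ (xB n))//.
  by rewrite ler_piMl ?rnorm_ge0.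
have yb : rnorm (window y N h t m) <= h ^+ 2 * b + e / 2 + 8 * B / N%:R.
  apply: window_le => //.
  have e'0 : 0 < e / 2 / h ^+ 2 by rewrite divr_gt0// exprn_gt0.
  have [J0 J0P] := hx s s1s _ e'0; exists J0 => J JJ.
  have -> : h ^+ 2 * b + e / 2 = h ^+ 2 * (b + e / 2 / h ^+ 2).
    by field; rewrite gt_eqF.
  apply: tent_series_le => //; [exact: ltW|by rewrite addr_ge0// ltW|].
  move=> u ut; have := J0P J JJ u ut; congr (rnorm _ <= _).
  apply: eq_bigr => j _; rewrite /y scalerA expr1n invr1 mul1r.
  by rewrite mulrC.
have xyb : rnorm (window x N h t m - window y N h t m) <= e / 2.
  rewrite (le_trans _ rL)//.
  have xyj j : (j <= m + N)%N -> rnorm (x j - y j) <= (m + N)%:R * B * r.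
    move=> jmN; rewrite /y -{1}(scale1r (x j)) -scalerBl.
    have /andP[q0 q1] := pow_near1 j (ltW r0).
    rewrite -[1]/(1%:C) -realCB rnormZ cabs_real ger0_norm//.
    rewrite [leRHS]mulrAC ler_pM ?rnorm_ge0// (le_trans q1)//.
    by rewrite ler_wpM2r ?(ltW r0)// ler_nat.
  set D := _ * B * r in xyj.
  have D0 : 0 <= D by rewrite /D mulr_ge0 ?(ltW r0)// mulr_ge0.
  have LD : (h ^+ 2 + 18 * h) * D <= L * r.
    have -> : L * r = (h ^+ 2 + 18 * h) * D + r by rewrite /L /D; ring.
    by rewrite lerDl ltW.
  rewrite (le_trans _ LD)// /window opprD addrACA -scalerBr -sumrB.
  rewrite (le_trans (rnormD _ _))// [leRHS]mulrDl lerD//.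
    rewrite rnormZ cabs_real ger0_norm ?sqr_ge0// ler_wpM2l ?sqr_ge0//.
    by rewrite xyj// leq_addr.
  rewrite (le_trans (rnorm_sum _ _ _))//.
  rewrite (le_trans (y := \sum_(n < N) tent h n.+1%:R * (2 * D)))//.
    apply: ler_sum => n _; rewrite -scalerBr rnormZ cabs_real.
    rewrite ger0_norm ?tent_ge0// ler_wpM2l ?tent_ge0//.
    rewrite opprD addrACA -!scalerBr (le_trans (rnormD _ _))//.
    rewrite !rnormZ !cabs_cis !mul1r.
    have := xyj (m + n.+1)%N; rewrite leq_add2l => /(_ (ltn_ord n)).
    have := xyj (m - n.+1)%N; rewrite (leq_trans (leq_subr _ _)) ?leq_addr//.
    by move=> /(_ isT); lra.
  rewrite -mulr_suml.
  have -> : 18 * h * D = 9 * h * (2 * D) by ring.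
  rewrite ler_wpM2r ?mulr_ge0 ?(ltW r0)//.
  apply: (@sum_tent_like _ (fun n => tent h n.+1%:R)) => // n _; split.
    exact: tent_le_sqr.
  by apply: tent_decay; rewrite pnatr_eq0.
by have := rnorm_le_add (window x N h t m) (window y N h t m); lra.
Qed.

End LocalEstimate.

(** * Translations on bounded sequences modulo null sequences *)

Section ShiftOperators.
Context {R : realType} (W : normedModType R[i]).
Implicit Types (x y : linf W) (q : linf_c0 W).

Lemma qclass_linear : linear (@qclass R W).
Proof. by move=> a x y; rewrite qclassD qclassZ. Qed.

HB.instance Definition _ :=
  GRing.isLinear.Build R[i] (linf W) (linf_c0 W) *:%R (@qclass R W) qclass_linear.

HB.instance Definition _ :=
  GRing.isLinear.Build R[i] (linf W) (linf W) *:%R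
    (@shiftS R W) (@shiftS_linear R W).

Lemma qclass_scale a x : qclass (a *: x) = a *: qclass x.
Proof. exact: qclassZ. Qed.

Lemma qclass_sum (I : Type) (r : seq I) (F : I -> linf W) :
  qclass (\sum_(i <- r) F i) = \sum_(i <- r) qclass (F i).
Proof. exact: (linear_sum (@qclass R W)). Qed.

Lemma rnorm_linf_ub x n : rnorm (x n) <= rnorm x.
Proof. by apply: (supnorm_ub (linf_bounded x)). Qed.

Lemma rnorm_linf_le x M : (forall n, rnorm (x n) <= M) -> rnorm x <= M.
Proof. by move=> xM; apply: supnorm_le => [|n _]; [exists 0%N|exact: xM]. Qed.

Lemma rnorm_qclass_le x : rnorm (qclass x) <= rnorm x.
Proof. exact: qdist_le. Qed.

Fact unshift_bounded x :
  (fun n => if n is m.+1 then x m else 0) \in @bounded_seq R W.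
Proof.
apply/bounded_seqP; exists (rnorm x) => -[|n] _; last exact: rnorm_linf_ub.
by rewrite rnorm0 rnorm_ge0.
Qed.

(** The right translation of a sequence, a one-sided inverse of [shiftS]. *)
Definition unshiftS x : linf W := Linf (unshift_bounded x).

Lemma unshiftS_linear : linear unshiftS.
Proof.
move=> a x y; apply/val_inj/funext => -[|n]//=.
by rewrite !fctE/= scaler0 addr0.
Qed.

HB.instance Definition _ :=
  GRing.isLinear.Build R[i] (linf W) (linf W) *:%R unshiftS unshiftS_linear.

Lemma shiftSK x : shiftS (unshiftS x) = x.
Proof. exact/val_inj. Qed.

Lemma rnorm_shiftS x : rnorm (shiftS x) <= rnorm x.
Proof. by apply: rnorm_linf_le => n; exact: (rnorm_linf_ub x n.+1). Qed.

Lemma rnorm_unshiftS x : rnorm (unshiftS x) <= rnorm x.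
Proof.
apply: rnorm_linf_le => -[|n] /=; first by rewrite rnorm0 rnorm_ge0.
exact: rnorm_linf_ub.
Qed.

Lemma iter_shiftSE x n m : iter n (@shiftS R W) x m = x (m + n)%N.
Proof. by elim: n m => [|n IH] m; rewrite ?addn0// iterS /= IH addSnnS. Qed.

Lemma iter_unshiftSE x n m : (n <= m)%N -> iter n unshiftS x m = x (m - n)%N.
Proof.
by elim: n m => [|n IH] [|m]// nm; rewrite ?subn0// iterS /= IH// subSS.
Qed.

Lemma linf_addE x y n : (x + y : linf W) n = x n + y n.
Proof. by []. Qed.

Lemma linf_scaleE a x n : (a *: x : linf W) n = a *: x n.
Proof. by []. Qed.

Lemma linf_sumE (I : Type) (r : seq I) (F : I -> linf W) n :
  (\sum_(i <- r) F i : linf W) n = \sum_(i <- r) F i n.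
Proof. by elim/big_rec2: _ => // i _ y _ <-. Qed.

Lemma second_diff_window N h t x m : (N <= m)%N ->
  second_diff (@shiftS R W) unshiftS N h t x m = window x N h t m.
Proof.
move=> Nm; rewrite /second_diff /window linf_addE linf_sumE; congr (_ + _).
apply: eq_bigr => n _; rewrite /harmonic linf_scaleE linf_addE !linf_scaleE.
rewrite -iter_shiftSE -iter_unshiftSE//.
by rewrite (leq_trans _ Nm).
Qed.

(** The operator induced by [unshiftS] on classes; it is the inverse of
    [shiftSbar]. *)
Definition unshiftSbar q : linf_c0 W := qclass (unshiftS (repr q)).

Lemma unshiftSbar_qclass x : unshiftSbar (qclass x) = qclass (unshiftS x).
Proof.
apply/qclass_eqP.
have /qclass_eqP : qclass (repr (qclass x)) = qclass x by rewrite qclassK.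
by rewrite -(cvg_shiftS (fun n => linf_val (unshiftS _ - unshiftS x) n)).
Qed.

Lemma unshiftSbar_linear : linear unshiftSbar.
Proof.
move=> a p q; rewrite -[p]qclassK -[q]qclassK -linearP !unshiftSbar_qclass.
by rewrite !linearP.
Qed.

HB.instance Definition _ := GRing.isLinear.Build R[i] (linf_c0 W) (linf_c0 W)
  *:%R unshiftSbar unshiftSbar_linear.

Lemma shiftSbarE x : shiftSbar W (qclass x) = qclass (shiftS x).
Proof. exact: shiftSbar_qclass. Qed.

Lemma unshiftSbarK q : shiftSbar W (unshiftSbar q) = q.
Proof. by rewrite -[q]qclassK unshiftSbar_qclass shiftSbarE shiftSK. Qed.

Lemma shiftSbarK q : unshiftSbar (shiftSbar W q) = q.
Proof.
rewrite -[q]qclassK shiftSbarE unshiftSbar_qclass; apply/qclass_eqP.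
rewrite -(cvg_shiftS (fun n => linf_val (_ - repr q) n)).
apply: (@cvg_trans _ ((fun=> 0 : W) @ \oo)); last exact: cvg_cst.
by apply: near_eq_cvg; near=> n; rewrite /= !fctE/= subrr.
Unshelve. all: by end_near.
Qed.

Lemma rnorm_shiftSbar_le q : rnorm (shiftSbar W q) <= rnorm q.
Proof.
apply: le_qdist => x <-; rewrite shiftSbarE.
exact: le_trans (rnorm_qclass_le _) (rnorm_shiftS _).
Qed.

Lemma rnorm_unshiftSbar_le q : rnorm (unshiftSbar q) <= rnorm q.
Proof.
apply: le_qdist => x <-; rewrite unshiftSbar_qclass.
exact: le_trans (rnorm_qclass_le _) (rnorm_unshiftS _).
Qed.

Lemma rnorm_shiftSbar q : rnorm (shiftSbar W q) = rnorm q.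
Proof.
apply/eqP; rewrite eq_le rnorm_shiftSbar_le/= -{1}[q]shiftSbarK.
exact: rnorm_unshiftSbar_le.
Qed.

Lemma rnorm_unshiftSbar q : rnorm (unshiftSbar q) = rnorm q.
Proof. by rewrite -{2}[q]unshiftSbarK rnorm_shiftSbar. Qed.

Lemma iter_shiftSbar n x :
  iter n (shiftSbar W) (qclass x) = qclass (iter n (@shiftS R W) x).
Proof. by elim: n => [//|n IH]; rewrite !iterS IH shiftSbarE. Qed.

Lemma iter_unshiftSbar n x :
  iter n unshiftSbar (qclass x) = qclass (iter n unshiftS x).
Proof. by elim: n => [//|n IH]; rewrite !iterS IH unshiftSbar_qclass. Qed.

(** Only the tail of a sequence matters for the norm of its class. *)
Lemma rnorm_qclass_tail x N M : (forall n, (N <= n)%N -> rnorm (x n) <= M) ->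
  rnorm (qclass x) <= M.
Proof.
move=> xM; rewrite -(rnorm_iter N _ rnorm_shiftSbar) iter_shiftSbar.
rewrite (le_trans (rnorm_qclass_le _))//; apply: rnorm_linf_le => n.
by rewrite iter_shiftSE xM// leq_addl.
Qed.

Lemma second_diff_qclass N h t x :
  second_diff (shiftSbar W) unshiftSbar N h t (qclass x) =
  qclass (second_diff (@shiftS R W) unshiftS N h t x).
Proof.
rewrite /second_diff qclassD qclass_scale qclass_sum; congr (_ + _).
apply: eq_bigr => n _; rewrite /harmonic qclass_scale qclassD !qclass_scale.
by rewrite iter_shiftSbar iter_unshiftSbar.
Qed.

End ShiftOperators.

Section Tauberian.
Context {R : realType} (W : normedModType R[i]).

Lemma zpartial_sub_first (x : nat -> W) w J s u : (0 < J)%N ->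
  zpartial (fun n => x n - (if n is 0 then w else 0)) J s u =
  zpartial x J s u - w.
Proof.
case: J => // J _; rewrite /zpartial !big_ord_recl/=.
rewrite expr0 invr1 mul0r oppr0 cis0 !mul1r !scale1r addrAC; congr (_ + _ - _).
by apply: eq_bigr => j _; rewrite subr0.
Qed.

(** A bounded sequence tends to [0] if its transform extends continuously across
    the circle off a countable set [E], and if at the points of [E] its class is
    in the closed range of [1 - cis (- t) *: shiftSbar W]. *)
Theorem tauberian (x : linf W) (E : set R[i]) : countable E ->
  (forall t, ~ E (cis t) -> exists w, forall b, 0 < b -> exists2 d, 0 < d &
     forall s, 1 < s < 1 + d -> forall e, 0 < e -> exists J0, forall J,
     (J0 <= J)%N -> forall u, `|u - t| <= d ->
     rnorm (zpartial x J s u - w) <= b + e) ->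
  (forall t, E (cis t) -> forall e, 0 < e -> exists p : linf_c0 W,
     rnorm (qclass x - (p - cis (- t) *: shiftSbar W p)) <= e) ->
  x n @[n --> \oo] --> (0 : W).
Proof.
move=> Ec Ereg Eex.
suff x0 : qclass x = 0.
  have : qclass x = qclass 0 by rewrite x0 qclass0.
  by move=> /qclass_eqP; rewrite subr0.
apply: (countable_spectrum (@rnorm_shiftSbar _ W) (@rnorm_unshiftSbar _ W)
  (@shiftSbarK _ W) Ec _ Eex).
move=> t nE e e0; have [w wP] := Ereg t nE.
have e20 : 0 < e / 2 by rewrite divr_gt0.
have [d d0 dP] := wP _ e20.
(* subtracting w from the first term makes the transform vanish at the point
   cis t without changing the class of x *)
pose y n := x n - (if n is 0 then w else 0).
have yb : y \in @bounded_seq R W.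
  apply/bounded_seqP; exists (rnorm x + rnorm w) => n _; rewrite /y.
  rewrite (le_trans (rnormB _ _))// lerD ?rnorm_linf_ub//.
  by case: n; rewrite ?rnorm0 ?rnorm_ge0.
pose z : linf W := Linf yb.
have xz : qclass x = qclass z.
  apply/qclass_eqP.
  rewrite -(cvg_shiftS (fun n => linf_val (x - z) n)).
  apply: (@cvg_trans _ ((fun=> 0 : W) @ \oo)); last exact: cvg_cst.
  by apply: near_eq_cvg; near=> n; rewrite /= !fctE/= /y subr0 subrr.
exists d => // h /andP[h0 hd].
have B0 : 0 <= 8 * rnorm z by rewrite mulr_ge0 ?rnorm_ge0.
have eh0 : 0 < e / 2 * h ^+ 2 by rewrite mulr_gt0// exprn_gt0.
have [N0 N0P] := real_inv_nat_small B0 eh0.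
exists N0 => N /N0P[Npos Ne].
rewrite xz second_diff_qclass; apply: (@rnorm_qclass_tail _ _ _ N) => m Nm.
rewrite second_diff_window// .
have -> : e * h ^+ 2 = h ^+ 2 * (e / 2) + e / 2 * h ^+ 2 by field.
rewrite (le_trans (y := h ^+ 2 * (e / 2) + 8 * rnorm z / N%:R))//; last first.
  by rewrite lerD2l.
apply: (@local_estimate _ _ _ _ _ _ _ (1 + d)) => //;
  rewrite ?(ltW e20) ?rnorm_ge0//.
- by move=> n; exact: rnorm_linf_ub.
- by rewrite ltrDl.
- move=> s sd e' e'0; have [J0 J0P] := dP s sd e' e'0.
  exists J0.+1 => J JJ u uh; rewrite zpartial_sub_first; last exact: leq_trans JJ.
  by apply: J0P; [exact: ltnW|rewrite (le_trans uh)// ltW].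
Unshelve. all: by end_near.
Qed.

End Tauberian.

(** * Completeness and the resolvent of the translation *)

(** Every Cauchy sequence converges, stated with real epsilons and real norms;
    the form of completeness used for [X] and for the operators on [X]. *)
Definition seq_complete {R : realType} (W : normedModType R[i]) :=
  forall u : nat -> W,
  (forall e : R, 0 < e -> exists N, forall n m, (N <= n)%N -> (N <= m)%N ->
     rnorm (u n - u m) <= e) ->
  exists l, forall e : R, 0 < e -> exists N, forall n, (N <= n)%N ->
     rnorm (u n - l) <= e.

Section Limits.
Context {R : realType} {W : normedModType R[i]}.

Lemma cvgn_rnormP (u : nat -> W) (l : W) :
  u n @[n --> \oo] --> l <-> forall e : R, 0 < e -> exists N, forall n,
    (N <= n)%N -> rnorm (u n - l) <= e.
Proof.
split=> [/cvgrPdist_le ul e e0|ul].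
  have e0' : (0 : R[i]) < e%:C by rewrite ltcR.
  have [N _ NP] := ul _ e0'; exists N => n Nn; have := NP n Nn.
  by rewrite /= rnormE lecR rnorm_distC.
apply/cvgrPdist_le => e e0.
have eR : e = (complex.Re e)%:C.
  by move: e0; case: e => a b; rewrite ltcE/= => /andP[/eqP ->].
have e0' : 0 < complex.Re e by move: e0; rewrite eR ltcR.
have [N NP] := ul _ e0'; exists N => // n Nn /=.
by rewrite eR rnormE lecR rnorm_distC NP.
Qed.

End Limits.

Lemma complete_seq_complete {R : realType} (X : completeNormedModType R[i]) :
  seq_complete X.
Proof.
move=> u uc.
have : cvgn u.
  apply/cauchy_cvgP/cauchy_exP => e e0.
  have eR : e = (complex.Re e)%:C.
    by move: e0; case: e => a b; rewrite ltcE/= => /andP[/eqP ->].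
  have e0' : 0 < complex.Re e / 2.
    by move: e0; rewrite eR ltcR => e0; rewrite divr_gt0.
  have [N NP] := uc _ e0'; exists (u N); exists N => // n Nn.
  rewrite -ball_normE /ball_/= eR rnormE ltcR (le_lt_trans (NP _ _ _ Nn))//.
  by lra.
by move=> /cvgn_rnormP ul; exists (limn u).
Qed.

Section BlopNorm.
Context {R : realType} {X : normedModType R[i]}.
Implicit Types (f g : blop X) (x : X).

Lemma rnorm_blop_apply f x : rnorm (f x) <= rnorm f * rnorm x.
Proof.
have [->|x0] := eqVneq x 0; first by rewrite linear0 rnorm0 mulr0.
have nx : 0 < rnorm x.
  rewrite lt_neqAle rnorm_ge0 andbT eq_sym; apply: contraNneq x0.
  by move=> /rnorm0_eq0 ->.
rewrite -ler_pdivrMr// mulrC -[(rnorm x)^-1]ger0_norm ?invr_ge0 ?rnorm_ge0//.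
rewrite -cabs_real -rnormZ -linearZ.
apply: (supnorm_ub (blop_bounded f)).
rewrite /unit_ball/= rnormE rnormZ cabs_real ger0_norm ?invr_ge0 ?rnorm_ge0//.
by rewrite mulVf ?gt_eqF.
Qed.

Lemma rnorm_blop_le f M : 0 <= M -> (forall x, rnorm (f x) <= M * rnorm x) ->
  rnorm f <= M.
Proof.
move=> M0 fM; apply: supnorm_le => [|x].
  by exists 0; rewrite /unit_ball/= normr0.
rewrite /unit_ball/= rnormE lecR => x1; rewrite (le_trans (fM x))//.
by rewrite ler_piMr.
Qed.

Lemma rnorm_blop_mul f g : rnorm (f * g) <= rnorm f * rnorm g.
Proof.
apply: rnorm_blop_le => [|x]; first by rewrite mulr_ge0 ?rnorm_ge0.
rewrite -mulrA (le_trans (rnorm_blop_apply f (g x)))//.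
by rewrite ler_wpM2l ?rnorm_ge0 ?rnorm_blop_apply.
Qed.

Lemma blop_seq_complete : seq_complete X -> seq_complete (blop X).
Proof.
move=> Xc u uc.
have ux x : exists l, forall e : R, 0 < e -> exists N, forall n, (N <= n)%N ->
     rnorm (u n x - l) <= e.
  apply: Xc => e e0.
  have e0' : 0 < e / (rnorm x + 1) by rewrite divr_gt0// ltr_wpDl ?rnorm_ge0.
  have [N NP] := uc _ e0'; exists N => n m Nn Nm.
  rewrite (le_trans (rnorm_blop_apply (u n - u m) x))//.
  rewrite (le_trans (ler_wpM2r (rnorm_ge0 _) (NP _ _ Nn Nm)))//.
  rewrite mulrAC ler_pdivrMr ?ltr_wpDl ?rnorm_ge0//.
  by rewrite ler_wpM2l ?(ltW e0)// lerDl.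
have {ux}[l lP] := choice ux.
have close e : 0 < e -> exists N, forall n, (N <= n)%N -> forall x,
    rnorm (u n x - l x) <= e * rnorm x.
  move=> e0; have [N NP] := uc _ e0; exists N => n Nn x.
  apply/ler_addgt0Pr => e' e'0; have [N' N'P] := lP x _ e'0.
  pose m := maxn N N'.
  have := N'P m (leq_maxr _ _).
  have : rnorm (u n x - u m x) <= e * rnorm x.
    rewrite (le_trans (rnorm_blop_apply (u n - u m) x))//.
    by rewrite ler_wpM2r ?rnorm_ge0// NP// leq_maxl.
  move=> h1 h2; rewrite -(subrKA (u m x)) (le_trans (rnormD _ _))//.
  exact: lerD.
have ll : linear l.
  move=> a x y; apply/eqP; rewrite -subr_eq0; apply/eqP/rnorm0_eq0.
  apply/eqP; rewrite eq_le rnorm_ge0 andbT; apply/ler_addgt0Pr => e e0.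
  rewrite add0r.
  pose c := rnorm (a *: x + y) + (cabs a * rnorm x + rnorm y).
  have c0 : 0 <= c by rewrite addr_ge0 ?addr_ge0 ?mulr_ge0 ?rnorm_ge0.
  have e0' : 0 < e / (c + 1) by rewrite divr_gt0// ltr_wpDl.
  have [N NP] := close _ e0'; have nP := NP N (leqnn _).
  have -> : l (a *: x + y) - (a *: l x + l y) =
     (a *: (u N x - l x) + (u N y - l y)) - (u N (a *: x + y) - l (a *: x + y)).
    by rewrite (linearP (u N)) scalerBr addrACA -opprD opprB [RHS]addrC subrKA.
  rewrite (le_trans (rnormB _ _))// (le_trans (lerD (rnormD _ _) (nP _)))//.
  rewrite rnormZ.
  rewrite (le_trans (lerD (lerD (ler_wpM2l (rnorm_ge0 _) (nP x)) (nP y))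
    (lexx _)))//.
  rewrite mulrCA -!mulrDr mulrAC ler_pdivrMr ?ltr_wpDl//.
  by rewrite ler_wpM2l ?(ltW e0)// addrC -/c lerDl.
have [N0 N0P] := close 1 ltr01.
have lb : l \in @bounded_op R X.
  apply/bounded_opP; split => //; exists (rnorm (u N0) + 1) => x.
  rewrite (le_trans (rnorm_le_add _ (u N0 x)))// mulrDl lerD ?rnorm_blop_apply//.
  by rewrite rnorm_distC N0P.
exists (Blop lb) => e e0; have [N NP] := close _ e0; exists N => n Nn.
by apply: rnorm_blop_le; [exact: ltW|exact: NP].
Qed.

End BlopNorm.

Section Powers.
Context {R : realType}.

(** Even multiplied by [N + 1], a geometric sequence is small. *)
Lemma geometric_small (s b e : R) : 1 < s -> 0 <= b -> 0 < e ->
  exists N0, forall N, (N0 <= N)%N -> b * (N.+1%:R * s ^- N) <= e.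
Proof.
move=> s1 b0 e0; pose r := s - 1; have r0 : 0 < r by rewrite subr_gt0.
have sE : s = 1 + r by rewrite /r; ring.
have spow N : 1 + N%:R * r + N%:R * (N%:R - 1) / 2 * r ^+ 2 <= s ^+ N.
  elim: N => [|N IH]; first by rewrite !mul0r !addr0 expr0.
  have s0 : 0 <= s by rewrite sE addr_ge0 ?ltW.
  rewrite (exprS s N) (le_trans _ (ler_wpM2l s0 IH))// sE -natr1 -subr_ge0.
  have -> : (1 + r) * (1 + N%:R * r + N%:R * (N%:R - 1) / 2 * r ^+ 2) -
    (1 + (N%:R + 1) * r + (N%:R + 1) * (N%:R + 1 - 1) / 2 * r ^+ 2) =
    (N%:R * (N%:R - 1) : R) * (r ^+ 3 / 2) by field.
  rewrite mulr_ge0 ?divr_ge0 ?exprn_ge0 ?(ltW r0)//.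
  by case: N {IH} => [|N]; rewrite ?mul0r// -natr1 addrK -natrD -natrM.
pose c := 2 / r ^+ 2 + 2 / r.
have c0 : 0 <= c by rewrite addr_ge0// divr_ge0 ?sqr_ge0 ?ltW.
have [N0 N0P] := real_inv_nat_small (mulr_ge0 b0 c0) e0.
exists N0 => N /N0P[Npos Ne].
have Nr : 0 < (N%:R : R) by rewrite ltr0n.
have sN : 0 < s ^+ N by rewrite exprn_gt0// sE addr_gt0.
rewrite (le_trans _ Ne)// -mulrA ler_wpM2l//.
rewrite ler_pdivrMr// mulrAC ler_pdivlMr//.
have h1 : N%:R * r <= s ^+ N.
  rewrite (le_trans _ (spow N))// -subr_ge0.
  have -> : 1 + N%:R * r + N%:R * (N%:R - 1) / 2 * r ^+ 2 - N%:R * r =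
    1 + (N%:R - 1) * (N%:R / 2 * r ^+ 2) by ring.
  by rewrite addr_ge0// mulr_ge0 ?subr_ge0 ?ler1n// mulr_ge0 ?sqr_ge0// divr_ge0.
have h2 : N%:R * (N%:R - 1) / 2 * r ^+ 2 <= s ^+ N.
  rewrite (le_trans _ (spow N))// lerDr addr_ge0// mulr_ge0// ltW//.
have -> : (N.+1%:R : R) * N%:R =
    2 / r ^+ 2 * (N%:R * (N%:R - 1) / 2 * r ^+ 2) + 2 / r * (N%:R * r).
  by rewrite -natr1; field; rewrite gt_eqF.
by rewrite /c [leRHS]mulrDl lerD// ler_wpM2l// divr_ge0 ?sqr_ge0// ltW.
Qed.

Lemma geometric_tail (r : R) N M : 0 <= r -> r < 1 ->
  \sum_(N <= n < M) r ^+ n <= r ^+ N / (1 - r).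
Proof.
move=> r0 r1; have d0 : 0 < 1 - r by rewrite subr_gt0.
rewrite ler_pdivlMr// mulr_suml.
have [MN|/ltnW NM] := leqP M N; first by rewrite big_geq// exprn_ge0.
rewrite (@GRing.telescope_sumr_eq _ _ _ (fun n => - r ^+ n))// => [|n _].
  by rewrite opprK addrC lerBlDr lerDl exprn_ge0.
by rewrite exprS; ring.
Qed.

Lemma cabs1 : cabs (1 : R[i]) = 1.
Proof. by rewrite -(cis0 (R := R)) cabs_cis. Qed.

Lemma cabsV (l : R[i]) : cabs l^-1 = (cabs l)^-1.
Proof.
have [->|l0] := eqVneq l 0; first by rewrite invr0 rnorm0 invr0.
have cl0 : cabs l != 0 by apply: contraNneq l0 => /rnorm0_eq0 ->.
by apply: (mulfI cl0); rewrite mulfV// -cabsM mulfV// cabs1.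
Qed.

Lemma cabsX (l : R[i]) n : cabs (l ^+ n) = cabs l ^+ n.
Proof.
elim: n => [|n IH]; first by rewrite !expr0 cabs1.
by rewrite !exprS cabsM IH.
Qed.

End Powers.

Section ShiftResolvent.
Context {R : realType} (W : normedModType R[i]).

Lemma shift_resolvent_bound (l : R[i]) (p : linf_c0 W) :
  (cabs l - 1) * rnorm p <= rnorm (l *: p - shiftSbar W p).
Proof.
rewrite mulrBl mul1r -rnormZ lerBlDr -(rnorm_shiftSbar p).
by rewrite -{1}(subrK (shiftSbar W p) (l *: p)) rnormD.
Qed.

(** The solution is the series [\sum_n l ^- n.+1 *: shiftS^n x]. *)
Lemma shift_resolvent_surj (l : R[i]) (x : linf W) : seq_complete W ->
  1 < cabs l -> exists y : linf W, l *: y - shiftS y = x.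
Proof.
move=> Wc l1.
have l0 : l != 0 by apply: contraTneq l1 => ->; rewrite rnorm0 -leNgt.
pose r := (cabs l)^-1.
have r0 : 0 <= r by rewrite invr_ge0 rnorm_ge0.
have r1 : r < 1 by rewrite invf_lt1// (lt_trans _ l1).
pose v m N := \sum_(n < N) l ^- n.+1 *: x (m + n)%N.
have vtail m N M : (N <= M)%N ->
    rnorm (v m M - v m N) <= rnorm x / (1 - r) * r ^+ N.
  move=> NM.
  have -> : v m M - v m N = \sum_(N <= n < M) l ^- n.+1 *: x (m + n)%N.
    rewrite /v -!(big_mkord xpredT (fun n => l ^- n.+1 *: x (m + n)%N)).
    by rewrite (big_cat_nat (n := N))//= addrAC subrr add0r.
  rewrite (le_trans (rnorm_sum _ _ _))//.
  rewrite (le_trans (y := \sum_(N <= n < M) rnorm x * r ^+ n))//.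
    rewrite ler_sum// => n _; rewrite rnormZ mulrC.
    rewrite ler_pM ?rnorm_ge0 ?rnorm_linf_ub//.
    by rewrite cabsV cabsX -exprVn -/r exprS ler_piMl ?exprn_ge0// ltW.
  rewrite -mulr_sumr -mulrA [_^-1 * _]mulrC ler_wpM2l ?rnorm_ge0//.
  exact: geometric_tail.
have C0 : 0 <= rnorm x / (1 - r) by rewrite divr_ge0 ?rnorm_ge0// subr_ge0 ltW.
have small e : 0 < e -> exists N0, forall N, (N0 <= N)%N ->
    rnorm x / (1 - r) * r ^+ N <= e.
  move=> e0; have [N0 N0P] := geometric_small l1 C0 e0.
  exists N0 => N /N0P; apply: le_trans; rewrite ler_wpM2l//.
  by rewrite /r exprVn ler_peMl ?ler1n// invr_ge0 exprn_ge0// rnorm_ge0.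
have vc m : exists a, forall e : R, 0 < e -> exists N, forall n, (N <= n)%N ->
     rnorm (v m n - a) <= e.
  apply: Wc => e e0; have [N NP] := small e e0; exists N => n k Nn Nk.
  have [nk|/ltnW kn] := leqP n k.
    by rewrite rnorm_distC (le_trans (vtail _ _ _ nk))// NP.
  by rewrite (le_trans (vtail _ _ _ kn))// NP.
have {vc}[y yP] := choice vc.
have yb : y \in @bounded_seq R W.
  apply/bounded_seqP; exists (1 + rnorm x / (1 - r)) => m _.
  have [N NP] := yP m 1 ltr01; have := NP N (leqnn _).
  rewrite rnorm_distC => h; rewrite -(subrK (v m N) (y m)).
  rewrite (le_trans (rnormD _ _))// lerD//.
  have := vtail m 0%N N (leq0n _).
  by rewrite {2}/v big_ord0 subr0 expr0 mulr1.
exists (Linf yb); apply/val_inj/funext => m /=; apply/eqP; rewrite -subr_eq0.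
apply/eqP/rnorm0_eq0/eqP; rewrite eq_le rnorm_ge0 andbT.
apply/ler_addgt0Pr => e e0; rewrite add0r.
have c0 : 0 < cabs l + 1 by rewrite ltr_wpDl ?rnorm_ge0.
have e'0 : 0 < e / (cabs l + 1) by rewrite divr_gt0.
have [N NP] := yP m _ e'0; have [N' N'P] := yP m.+1 _ e'0.
pose K := maxn N N'.
have hx : l *: v m K.+1 - v m.+1 K = x m.
  rewrite /v big_ord_recl/= addn0 expr1 scalerDr scalerA mulfV// scale1r.
  rewrite scaler_sumr -addrA -sumrB big1 ?addr0// => n _.
  rewrite scalerA /bump/= add1n addSnnS (exprS l n.+1) invfM mulrA mulfV// mul1r.
  by rewrite subrr.
have -> : l *: y m - y m.+1 - x m =
    (v m.+1 K - y m.+1) - l *: (v m K.+1 - y m).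
  rewrite -hx scalerBr !opprB [LHS]addrACA [RHS]addrACA.
  by congr (_ + _); rewrite addrC.
rewrite (le_trans (rnormB _ _))// rnormZ.
have h1 := N'P K (leq_maxr _ _).
have h2 : rnorm (v m K.+1 - y m) <= e / (cabs l + 1).
  by apply: NP; rewrite (leq_trans (leq_maxl N N')).
rewrite (le_trans (lerD h1 (ler_wpM2l (rnorm_ge0 _) h2)))//.
by rewrite -{1}[e / _]mul1r -mulrDl addrC mulrC divfK// gt_eqF.
Qed.

(** [l - shiftSbar W] is surjective by the previous lemma and bounded below
    because [shiftSbar W] is an isometry. *)
Lemma shift_resolvent_invertible (l : R[i]) : seq_complete W -> 1 < cabs l ->
  invertible (l *: (1 : blop (linf_c0 W)) - shiftSbar W).
Proof.
move=> Wc l1; have l10 : 0 < cabs l - 1 by rewrite subr_gt0.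
pose D (p : linf_c0 W) := l *: p - shiftSbar W p.
have DE p : (l *: (1 : blop (linf_c0 W)) - shiftSbar W) p = D p by [].
have DL : linear D.
  move=> a p p'; rewrite -!DE; exact: linearP.
have Db p : rnorm p <= (cabs l - 1)^-1 * rnorm (D p).
  by rewrite ler_pdivlMl// shift_resolvent_bound.
have DI p p' : D p = D p' -> p = p'.
  move=> pp'; apply/eqP; rewrite -subr_eq0; apply/eqP/rnorm0_eq0/eqP.
  rewrite eq_le rnorm_ge0 andbT (le_trans (Db _))//.
  by rewrite -(scaleN1r p') (addrC p) DL scaleN1r pp' addNr rnorm0 mulr0.
have ex q : exists p, D p = q.
  have [y yx] := shift_resolvent_surj (repr q) Wc l1.
  exists (qclass y); rewrite /D -[q]qclassK -yx shiftSbarE -qclass_scale.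
  by rewrite -[- qclass _]scaleN1r -qclass_scale -qclassD scaleN1r.
have [g gP] := choice ex.
have gb : g \in @bounded_op R (linf_c0 W).
  apply/bounded_opP; split.
    by move=> a p p'; apply: DI; rewrite DL !gP.
  by exists (cabs l - 1)^-1 => p; rewrite -{2}(gP p).
exists (Blop gb); split; apply/val_inj/funext => p; last exact: (gP p).
exact: (DI _ _ (gP (D p))).
Qed.

End ShiftResolvent.

(** * The Z-transform of a solution *)

Lemma holomorphic_continuous {R : realType} {V : normedModType R[i]}
    (F : R[i] -> V) (z0 : R[i]) :
  derivable (F : R[i]^o -> V) z0 1 -> forall e : R, 0 < e ->
  exists2 d : R, 0 < d & forall z, cabs (z - z0) < d -> rnorm (F z - F z0) <= e.
Proof.
move=> /derivable1_diffP/differentiable_continuous Fc e e0.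
have e0' : (0 : R[i]) < e%:C by rewrite ltcR.
move/cvgrPdist_le : Fc => /(_ _ e0') /nbhs_ballP[d /= d0 dP].
have dR : d = (complex.Re d)%:C.
  by move: d0; case: (d) => a b; rewrite ltcE/= => /andP[/eqP ->].
exists (complex.Re d); first by move: d0; rewrite dR ltcR.
move=> z zz0; have zd : ball (z0 : R[i]^o) d z.
  rewrite -ball_normE /ball_/= dR (rnormE (z0 - z : R[i]^o)) ltcR.
  by rewrite rnorm_distC.
by have := dP z zd; rewrite /= rnormE lecR rnorm_distC.
Qed.

Lemma cisV {R : realType} (t : R) : (cis t)^-1 = cis (- t).
Proof.
rewrite -[LHS]mul1r -(cisNK t) mulfK//.
apply/eqP => t0; have := cabs_cis t; rewrite t0 rnorm0 => /esym/eqP.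
by rewrite oner_eq0.
Qed.

Lemma cabs_polar {R : realType} (s t : R) : 0 <= s -> cabs (s%:C * cis t) = s.
Proof. by move=> s0; rewrite cabsM cabs_cis cabs_real mulr1 ger0_norm. Qed.

Lemma cabs_polar_dist {R : realType} (s t u : R) : 1 <= s ->
  cabs (s%:C * cis u - cis t) <= (s - 1) + `|u - t|.
Proof.
move=> s1.
have -> : s%:C * cis u - cis t = (s - 1)%:C * cis u - cis t * (1 - cis (u - t)).
  rewrite mulrBr mulr1 -cisD (addrC t) subrK realCB.
  by rewrite -[1%:C]/(1 : R[i]); ring.
rewrite (le_trans (rnormB (_ : R[i]^o) _))// lerD//.
  by rewrite cabs_polar// subr_ge0.
by rewrite cabsM cabs_cis mul1r cabs_one_sub_cis.
Qed.

Section Transform.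
Context {R : realType} {X : completeNormedModType R[i]}.
Variables (A : blop X) (B : nat -> blop X) (b : R).
Hypothesis B_bounded : forall n, rnorm (B n) <= b.

Let b0 : 0 <= b := le_trans (rnorm_ge0 _) (B_bounded 0%N).

Lemma cabs_powV (z : R[i]) n : cabs (z ^- n) = (cabs z)^-1 ^+ n.
Proof. by rewrite cabsV cabsX exprVn. Qed.

Lemma Ztransform_tail (z : R[i]) M : 1 < cabs z ->
  rnorm (Ztransform B z - series (fun j => z ^- j *: B j) M) <=
  b / (1 - (cabs z)^-1) * (cabs z)^-1 ^+ M.
Proof.
move=> z1; set r := (cabs z)^-1; set S := series _.
have r0 : 0 <= r by rewrite invr_ge0 rnorm_ge0.
have r1 : r < 1 by rewrite invf_lt1// (lt_trans _ z1).
have C0 : 0 <= b / (1 - r) by rewrite divr_ge0// subr_ge0 ltW.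
have tail N K : (N <= K)%N -> rnorm (S K - S N) <= b / (1 - r) * r ^+ N.
  move=> NK; rewrite /S /series/= (big_cat_nat (n := N))//= addrAC subrr add0r.
  rewrite (le_trans (rnorm_sum _ _ _))//.
  rewrite (le_trans (y := \sum_(N <= n < K) b * r ^+ n))//.
    rewrite ler_sum// => n _; rewrite rnormZ mulrC cabs_powV.
    by rewrite ler_wpM2r ?exprn_ge0.
  by rewrite -mulr_sumr -mulrA [_^-1 * _]mulrC ler_wpM2l ?geometric_tail.
have small e : 0 < e -> exists N0, forall N, (N0 <= N)%N ->
    b / (1 - r) * r ^+ N <= e.
  move=> e0; have [N0 N0P] := geometric_small z1 C0 e0.
  exists N0 => N /N0P; apply: le_trans; rewrite ler_wpM2l//.
  by rewrite /r exprVn ler_peMl ?ler1n// invr_ge0 exprn_ge0// rnorm_ge0.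
have [l lP] : exists l, forall e : R, 0 < e -> exists N, forall n, (N <= n)%N ->
     rnorm (S n - l) <= e.
  apply: (blop_seq_complete (@complete_seq_complete _ X)) => e e0.
  have [N NP] := small e e0; exists N => n k Nn Nk.
  have [nk|/ltnW kn] := leqP n k.
    by rewrite rnorm_distC (le_trans (tail _ _ nk))// NP.
  by rewrite (le_trans (tail _ _ kn))// NP.
have -> : Ztransform B z = l.
  apply: cvg_lim; first exact: norm_hausdorff.
  exact/cvgn_rnormP.
apply/ler_addgt0Pr => e e0; have [N NP] := lP e e0.
pose K := maxn M N.
rewrite -(subrKA (S K)) (le_trans (rnormD _ _))// addrC lerD//.
  exact/tail/leq_maxl.
by rewrite rnorm_distC NP// leq_maxr.
Qed.

(** [W] is a module over the algebra of operators, so that the two cases [W = X]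
    and [W = blop X] (acting by left multiplication) are treated at once. *)
Variable W : normedModType R[i].
Variable act : blop X -> W -> W.
Hypothesis act_linear : forall f, linear (act f).
Hypothesis act_linearl : forall w, linear (act ^~ w).
Hypothesis actM : forall f g w, act (f * g) w = act f (act g w).
Hypothesis act1 : forall w, act 1 w = w.
Hypothesis act_le : forall f w, rnorm (act f w) <= rnorm f * rnorm w.

Variable x : nat -> W.
Hypothesis x_solution : forall n,
  x n.+1 = act A (x n) + \sum_(k < n.+1) act (B (n - k)%N) (x k).
Variable M : R.
Hypothesis x_bounded : forall n, rnorm (x n) <= M.

Let actZr f a w : act f (a *: w) = a *: act f w.
Proof.
have act0 : act f 0 = 0.
  have := act_linear f 1 0 0; rewrite !scale1r !addr0 => h.
  by apply: (@addrI _ (act f 0)); rewrite addr0 -h.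
by have := act_linear f a w 0; rewrite act0 !addr0.
Qed.

Let actDr f u v : act f (u + v) = act f u + act f v.
Proof. by have := act_linear f 1 u v; rewrite !scale1r. Qed.

Let act0r f : act f 0 = 0.
Proof. by have := actZr f 0 0; rewrite !scale0r. Qed.

Let actDl f g w : act (f + g) w = act f w + act g w.
Proof. by have := act_linearl w 1 f g; rewrite !scale1r. Qed.

Let act0l w : act 0 w = 0.
Proof. by apply: (@addrI _ (act 0 w)); rewrite -actDl !addr0. Qed.

Let actZl a f w : act (a *: f) w = a *: act f w.
Proof. by have := act_linearl w a f 0; rewrite act0l !addr0. Qed.

Let actBl f g w : act (f - g) w = act f w - act g w.
Proof. by rewrite -(scaleN1r g) actDl actZl scaleN1r. Qed.

Let actBr f u v : act f (u - v) = act f u - act f v.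
Proof. by rewrite -scaleN1r actDr actZr scaleN1r. Qed.

Let act_sumr f (I : Type) (r : seq I) (F : I -> W) :
  act f (\sum_(i <- r) F i) = \sum_(i <- r) act f (F i).
Proof. by elim/big_rec2: _ => // i u v _ <-; rewrite actDr. Qed.

Let ser (z : R[i]) N : W := \sum_(n < N) z ^- n *: x n.
Let Bser (z : R[i]) : nat -> blop X := series (fun j => z ^- j *: B j).

Let serS z N : ser z N.+1 = ser z N + z ^- N *: x N.
Proof. by rewrite /ser big_ord_recr. Qed.

(** The Z-transform of the equation, for partial sums: the Cauchy product is
    arranged along the values of [x]. *)
Lemma ser_recurrence z N : z != 0 ->
  z *: (ser z N.+1 - x 0%N) =
  act A (ser z N) + \sum_(k < N) act (Bser z (N - k)%N) (z ^- k *: x k).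
Proof.
move=> z0; elim: N => [|N IH].
  rewrite /ser big_ord1 !big_ord0 expr0 invr1 scale1r subrr scaler0 act0r.
  by rewrite addr0.
have -> : \sum_(k < N.+1) act (Bser z (N.+1 - k)%N) (z ^- k *: x k) =
    \sum_(k < N) act (Bser z (N - k)%N) (z ^- k *: x k) +
    z ^- N *: \sum_(k < N.+1) act (B (N - k)%N) (x k).
  rewrite -[X in X + _](addr0) -[X in _ + X + _](_ : act (Bser z (N - N)%N)
    (z ^- N *: x N) = _); last by rewrite subnn /Bser /series/= big_geq// act0l.
  rewrite -(big_ord_recr N (fun k => act (Bser z (N - k)%N) (z ^- k *: x k)))/=.
  rewrite scaler_sumr -big_split/=; apply: eq_bigr => k _.
  have kN : (k <= N)%N by rewrite -ltnS.
  rewrite subSn// /Bser /series/= big_nat_recr//= actDl actZl !actZr scalerA.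
  congr (_ + _ *: _); rewrite -invfM -exprD; congr (_ ^- _).
  by rewrite subnK.
rewrite (serS z N.+1) addrAC scalerDr IH scalerA.
rewrite exprS invfM mulrA mulfV// mul1r x_solution scalerDr.
by rewrite (serS z N) actDr actZr addrACA.
Qed.

Let P z := z *: (1 : blop X) - A - Ztransform B z.

Lemma ser_error z N : 1 < cabs z ->
  rnorm (act (P z) (ser z N) - z *: x 0%N) <=
  (b / (1 - (cabs z)^-1) + cabs z) * M * (N.+1%:R * cabs z ^- N).
Proof.
move=> z1.
have z0 : z != 0 by apply: contraTneq z1 => ->; rewrite rnorm0 -leNgt.
have M0 : 0 <= M by exact: le_trans (rnorm_ge0 _) (x_bounded 0%N).
set r := (cabs z)^-1; set C := b / (1 - r).
have r0 : 0 <= r by rewrite invr_ge0 rnorm_ge0.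
have r1 : r < 1 by rewrite invf_lt1// (lt_trans _ z1).
have C0 : 0 <= C by rewrite divr_ge0// subr_ge0 ltW.
have -> : act (P z) (ser z N) - z *: x 0%N =
  - (\sum_(k < N) act (Ztransform B z - Bser z (N - k)%N) (z ^- k *: x k)
     + z *: (z ^- N *: x N)).
  have -> : \sum_(k < N) act (Ztransform B z - Bser z (N - k)%N) (z ^- k *: x k) =
      act (Ztransform B z) (ser z N) -
      \sum_(k < N) act (Bser z (N - k)%N) (z ^- k *: x k).
    by rewrite act_sumr -sumrB; apply: eq_bigr => k _; rewrite actBl.
  have := ser_recurrence N z0.
  set Q := \sum_(k < N) _; rewrite serS.
  rewrite addrAC scalerDr scalerBr => h.
  have -> : z *: (z ^- N *: x N) =
      act A (ser z N) + Q - (z *: ser z N - z *: x 0%N).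
    by rewrite -h addrAC subrr add0r.
  rewrite !actBl actZl act1.
  set a := act A _; set c := act (Ztransform B z) _.
  set u := z *: ser z N; set v := z *: x 0%N.
  rewrite (addrC a Q) -(addrA Q) (addrA (c - Q)) subrK opprD opprB.
  by rewrite [LHS]addrAC [RHS]addrC; congr (_ - _); rewrite addrAC.
rewrite rnormN (le_trans (rnormD _ _))//.
have -> : (C + cabs z) * M * (N.+1%:R * cabs z ^- N) =
   C * M * (N.+1%:R * r ^+ N) + cabs z * (M * (N.+1%:R * r ^+ N)).
  by rewrite /r exprVn; ring.
have N1 : r ^+ N <= N.+1%:R * r ^+ N by rewrite ler_peMl ?exprn_ge0// ler1n.
rewrite lerD//; last first.
  rewrite !rnormZ cabs_powV -/r ler_wpM2l ?rnorm_ge0// mulrC.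
  by rewrite ler_pM ?rnorm_ge0 ?exprn_ge0.
rewrite (le_trans (rnorm_sum _ _ _))//.
rewrite (le_trans (y := \sum_(k < N) C * M * r ^+ N))//; last first.
  rewrite sumr_const card_ord -[_ *+ N]mulr_natl [leLHS]mulrCA.
  rewrite ler_wpM2l ?(mulr_ge0 C0 M0)//.
  by rewrite ler_wpM2r ?exprn_ge0// ler_nat.
apply: ler_sum => k _; rewrite (le_trans (act_le _ _))//.
rewrite (le_trans (ler_wpM2r (rnorm_ge0 _) (Ztransform_tail _ z1)))//.
rewrite -/r -/C rnormZ cabs_powV -/r.
have -> : r ^+ N = r ^+ (N - k) * r ^+ k by rewrite -exprD subnK// ltnW.
have -> : C * M * (r ^+ (N - k) * r ^+ k) = C * r ^+ (N - k) * (r ^+ k * M).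
  by ring.
by rewrite ler_wpM2l ?(mulr_ge0 C0) ?exprn_ge0// ler_wpM2l ?exprn_ge0.
Qed.

(** The transform of [x] is the inverse of [P z] applied to [z *: x 0], with a
    rate of convergence that depends on [z] only through its modulus and the norm
    of that inverse. *)
Lemma ser_limit z N : 1 < cabs z -> invertible (P z) ->
  rnorm (ser z N - act (blop_inv (P z)) (z *: x 0%N)) <=
  rnorm (blop_inv (P z)) *
  ((b / (1 - (cabs z)^-1) + cabs z) * M * (N.+1%:R * cabs z ^- N)).
Proof.
move=> z1 /blop_invP[PK _].
have -> : ser z N - act (blop_inv (P z)) (z *: x 0%N) =
    act (blop_inv (P z)) (act (P z) (ser z N) - z *: x 0%N).
  by rewrite actBr -actM PK act1.
by rewrite (le_trans (act_le _ _))// ler_wpM2l ?rnorm_ge0// ser_error.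
Qed.

Lemma zpartialE s t N : zpartial x N s t = ser (s%:C * cis t) N.
Proof.
apply: eq_bigr => n _; congr (_ *: _).
rewrite exprMn invfM -cisMn cisV mulr_natl; congr (_ * _).
by rewrite -(rmorphXn (real_complex R)) -(fmorphV (real_complex R)).
Qed.

(** At a regular point the transform of [x] has a continuous extension, whose
    value there is [w]. *)
Lemma regular_zpartial t : regular A B (cis t) ->
  exists w, forall e1, 0 < e1 -> exists2 d, 0 < d &
     forall s, 1 < s < 1 + d -> forall e, 0 < e -> exists J0, forall J,
     (J0 <= J)%N -> forall u, `|u - t| <= d ->
     rnorm (zpartial x J s u - w) <= e1 + e.
Proof.
move=> [r r0 [G [_ GZ Pinv Phol]]].
pose V z := blop_inv (z *: (1 : blop X) - A - G z).
have z0D : open_disk (cis t) r (cis t).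
  by rewrite /open_disk/= subrr normr0 ltcR.
exists (act (V (cis t)) (cis t *: x 0%N)) => e1 e10.
have M0 : 0 <= M by exact: le_trans (rnorm_ge0 _) (x_bounded 0%N).
pose m := rnorm (x 0%N) + 1.
have m0 : 0 < m by rewrite ltr_wpDl ?rnorm_ge0.
pose K := rnorm (V (cis t)).
have K0 : 0 <= K by exact: rnorm_ge0.
have tol0 : 0 < Num.min 1 (e1 / (4 * m)).
  by rewrite lt_min ltr01 divr_gt0// mulr_gt0.
have [d1 d10 d1P] := holomorphic_continuous (Phol _ z0D) tol0.
pose d := Num.min (Num.min (r / 3) (d1 / 3))
  (Num.min 1 (e1 / (4 * ((K + 1) * m)))).
have d0 : 0 < d.
  by rewrite !lt_min !divr_gt0//= ?ltr01// !mulr_gt0// ltr_wpDl.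
have [dr dd1 d11 dK] : [/\ d <= r / 3, d <= d1 / 3, d <= 1 &
    d <= e1 / (4 * ((K + 1) * m))].
  by split; rewrite !ge_min lexx ?orbT.
exists d => // s /andP[s1 sd] e e0.
have s0 : 0 <= s by lra.
pose C := (K + 1) * ((b / (1 - s^-1) + s) * M).
have sV1 : s^-1 < 1 by rewrite invf_lt1//; lra.
have C0 : 0 <= C.
  by rewrite !mulr_ge0// addr_ge0// divr_ge0// subr_ge0 ltW.
have [J0 J0P] := geometric_small s1 C0 e0.
exists J0 => J JJ u ud; rewrite zpartialE; set z := s%:C * cis u.
have cz : cabs z = s by rewrite cabs_polar.
have zz0 : cabs (z - cis t) <= 2 * d.
  by rewrite (le_trans (cabs_polar_dist _ _ _)) ?(ltW s1)//; lra.
have zD : open_disk (cis t) r z.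
  rewrite /open_disk/= (rnormE (z - cis t : R[i]^o)) ltcR.
  by rewrite (le_lt_trans zz0)//; lra.
have cz1 : 1 < cabs z by rewrite cz.
have Gz : G z = Ztransform B z.
  by apply: GZ => //; rewrite (rnormE (z : R[i]^o)) -[1]/(1%:C) ltcR.
have Pz : invertible (P z) by rewrite /P -Gz; exact: Pinv.
have VP : blop_inv (P z) = V z by rewrite /V Gz.
have Vz : rnorm (V z - V (cis t)) <= Num.min 1 (e1 / (4 * m)).
  by apply: d1P; rewrite (le_lt_trans zz0)//; lra.
move: Vz; rewrite le_min => /andP[Vz1 Vze].
rewrite -(subrKA (act (V z) (z *: x 0%N))) (le_trans (rnormD _ _))// addrC lerD//.
  have -> : act (V z) (z *: x 0%N) - act (V (cis t)) (cis t *: x 0%N) =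
    act (V z - V (cis t)) (z *: x 0%N) + act (V (cis t)) ((z - cis t) *: x 0%N).
    by rewrite actBl scalerBl actBr subrKA.
  rewrite (le_trans (rnormD _ _))//.
  have -> : e1 = e1 / 2 + e1 / 2 by field.
  have xm : rnorm (x 0%N) <= m by rewrite lerDl.
  rewrite lerD// (le_trans (act_le _ _))// rnormZ.
    have -> : e1 / 2 = e1 / (4 * m) * (2 * m) by field; rewrite gt_eqF.
    by rewrite ler_pM ?mulr_ge0 ?rnorm_ge0// ler_pM ?rnorm_ge0// cz; lra.
  rewrite -/K (le_trans (y := K * (2 * d * m)))//.
    by rewrite ler_wpM2l// ler_pM ?rnorm_ge0.
  rewrite (le_trans (y := (K + 1) * (2 * d * m)))//.
    by rewrite ler_wpM2r ?lerDl// !mulr_ge0// ltW.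
  have -> : (K + 1) * (2 * d * m) = 2 * ((K + 1) * m) * d by ring.
  have Km0 : 0 < (K + 1) * m by rewrite mulr_gt0// ltr_wpDl.
  have Km2 : 0 <= 2 * ((K + 1) * m) by rewrite mulr_ge0// ltW.
  rewrite (le_trans (ler_wpM2l Km2 dK))//.
  move: Km0; set k := (K + 1) * m => k0.
  by rewrite le_eqVlt; apply/orP; left; apply/eqP; field; rewrite gt_eqF.
rewrite -VP (le_trans (ser_limit _ cz1 Pz))// (le_trans _ (J0P J JJ))// cz VP.
rewrite /C -(mulrA (K + 1)) ler_pM ?rnorm_ge0//.
  rewrite mulr_ge0 ?mulr_ge0 ?invr_ge0 ?exprn_ge0//.
  by rewrite addr_ge0// divr_ge0// subr_ge0 ltW.
by rewrite (le_trans (rnorm_le_add _ (V (cis t))))// lerD.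
Qed.

End Transform.

(** * Stability *)

Lemma summable_bounded {R : realType} {V : normedModType R[i]} (B : nat -> V) :
  cvgn ([normed series B] : nat -> R[i]^o) ->
  exists b : R, forall n, rnorm (B n) <= b.
Proof.
move=> Bs.
have FT : ProperFilter (globally [set: nat]).
  by apply: (@globally_properfilter _ _ 0%N).
have : cvgn (fun n => `|B n| : R[i]^o).
  by apply/cvg_ex; exists 0; exact: (@cvg_series_cvg_0 R[i] R[i]^o _ Bs).
move=> /cvg_seq_bounded Bb.
have [M BM] := (ex_bound _).1 Bb.
exists (complex.Re M) => n; have := BM n I.
by rewrite /= normr_id rnormE lecE/= => /andP[].
Qed.

(** The radial condition at [cis t] puts [q] in the closed range of
    [1 - cis (- t) *: shiftSbar]: for [p] the resolvent applied to [q],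
    [q - (l - cis t) *: p] is [cis t *: p - shiftSbar W p]. *)
Lemma radial_lim_closed_range {R : realType} (W : normedModType R[i])
    (q : linf_c0 W) t : seq_complete W ->
  radial_lim (fun l => (l - cis t) *: resolvent l (shiftSbar W) q) (cis t) 0 ->
  forall e, 0 < e ->
  exists p, rnorm (q - (p - cis (- t) *: shiftSbar W p)) <= e.
Proof.
move=> Wc rl e e0.
have e0' : (0 : R[i]) < e%:C by rewrite ltcR.
have near1 : \forall s \near 1^'+, `|0 - (s%:C * cis t - cis t) *:
    resolvent (s%:C * cis t) (shiftSbar W) q| <= e%:C.
  by move/cvgrPdist_le : rl => /(_ _ e0').
have [s [sl s1]] := filter_ex (filterI near1 (nbhs_right_gt 1)).
set l := s%:C * cis t in sl.
have l1 : 1 < cabs l by rewrite cabs_polar// ltW// (lt_trans _ s1).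
have [_ DR] := blop_invP (shift_resolvent_invertible Wc l1).
set p := resolvent l (shiftSbar W) q in sl.
have qp : q = l *: p - shiftSbar W p.
  by have := congr1 (fun f : blop (linf_c0 W) => f q) DR; move=> /= <-.
exists (cis t *: p).
have -> : q - (cis t *: p - cis (- t) *: shiftSbar W (cis t *: p)) =
    (l - cis t) *: p.
  rewrite {1}qp [shiftSbar W (_ *: p)]linearZ/= scalerA cisNK scale1r scalerBl.
  by rewrite opprB addrA subrK.
by move: sl; rewrite /= sub0r normrN rnormE lecR.
Qed.

Section Stability.
Context {R : realType} {X : completeNormedModType R[i]}.
Variables (A : blop X) (B : nat -> blop X).
Hypothesis B_summable : cvgn [normed series B].
Hypothesis Sigma_countable : countable (Sigma A B).

(** Both assertions of the theorem: [W] is either [X] or the algebra of bounded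
    operators on [X]. *)
Theorem stability (W : normedModType R[i]) (act : blop X -> W -> W)
    (x : linf W) :
  seq_complete W ->
  (forall f, linear (act f)) -> (forall w, linear (act ^~ w)) ->
  (forall f g w, act (f * g) w = act f (act g w)) ->
  (forall w, act 1 w = w) ->
  (forall f w, rnorm (act f w) <= rnorm f * rnorm w) ->
  (forall n, x n.+1 = act A (x n) + \sum_(k < n.+1) act (B (n - k)%N) (x k)) ->
  (forall xi0 : R[i], Sigma A B xi0 ->
    radial_lim (fun l => (l - xi0) *: resolvent l (shiftSbar W) (qclass x))
      xi0 0) ->
  x n @[n --> \oo] --> (0 : W).
Proof.
move=> Wc aL aLl aM a1 a_le xS xR.
have [b Bb] := summable_bounded B_summable.
apply: (tauberian Sigma_countable) => t.
  move=> nS; have tR : regular A B (cis t).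
    apply: contrapT => nR; apply: nS; split=> //.
    by rewrite (rnormE (cis t : R[i]^o)) cabs_cis.
  exact: (regular_zpartial Bb aL aLl aM a1 a_le xS (rnorm_linf_ub x) tR).
by move=> /xR; exact: radial_lim_closed_range.
Qed.

End Stability.

Theorem theorem4p5 (R : realType) (X : completeNormedModType R[i])
    (A : blop X) (B : nat -> blop X)
    (Bsummable : cvgn [normed series B])
    (Sigma_countable : countable (Sigma A B)) :
  (forall x : linf X,
     solution A B x ->
     (forall xi0 : R[i], Sigma A B xi0 ->
        radial_lim
          (fun l : R[i] =>
             (l - xi0) *: resolvent l (shiftSbar X) (qclass x))
          xi0 0) ->
     x n @[n --> \oo] --> (0 : X)) /\
  (forall U : linf (blop X),
     resolvent_sequence A B U ->
     (forall xi0 : R[i], Sigma A B xi0 ->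
        radial_lim
          (fun l : R[i] =>
             (l - xi0) *: resolvent l (shiftSbar (blop X)) (qclass U))
          xi0 0) ->
     U n @[n --> \oo] --> (0 : blop X)).
Proof.
split=> [x xS xR|U [_ US] UR].
  apply: (stability Bsummable Sigma_countable (act := fun f w => f w)) => //.
  - exact: complete_seq_complete.
  - by move=> f a u v; exact: linearP.
  - exact: rnorm_blop_apply.
apply: (stability Bsummable Sigma_countable (act := fun f g => f * g)) => //.
- exact/blop_seq_complete/complete_seq_complete.
- by move=> f a u v; apply/val_inj/funext => w; exact: linearP.
- by move=> w a f g; apply/val_inj.
- by move=> f g w; rewrite mulrA.
- by move=> f; rewrite mul1r.
- exact: rnorm_blop_mul.
Qed.
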